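(* Let $R=\bigoplus_{\gamma\in\Gamma}R_\gamma$ be an $n$-dimensional ($n\ge1$) finitely generated graded domain over $\mathbb{k}$ with $R_0=\mathbb{k}$, where $\Gamma\subset\mathbb{R}_{\ge0}$ is a finitely generated sub-semigroup, and let $M=\bigoplus_{\lambda\in\mathbb{R}}M_\lambda$ be a finitely generated $\mathbb{R}$-graded $R$-module. Then there exist constants $a_n(M),a_{n-1}(M)\in\mathbb{R}$ such that $$\dim_{\mathbb{k}}(M_{\le x})=\frac{a_n(M)}{n!}x^n+O(x^{n-1})\quad(x\to\infty),$$ $$\lim_{T\to\infty}\frac1{T^n}\int_1^T\left(\dim_{\mathbb{k}}(M_{\le x})-\frac{a_n(M)}{n!}x^n-\frac{a_{n-1}(M)}{(n-1)!}x^{n-1}\right)dx=0.$$ Moreover, $a_n(M)=\operatorname{rank}(M)\,a_n(R)$.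
   Context: $\mathbb{k}$ is an algebraically closed field. $M_{\le x}:=\bigoplus_{\lambda\le x}M_\lambda$. $\operatorname{rank}(M)=\dim_{K(R)}(M\otimes_RK(R))$, where $K(R)$ is the fraction field of $R$; $a_n(R)$ is the constant for $M=R$. *)

(* Defs.v *)
From HB Require Import structures.
From mathcomp Require Import all_boot all_order all_algebra.
From mathcomp Require Import all_classical all_reals all_analysis.
From mathcomp.multinomials Require Import freeg.

Set Implicit Arguments.
Unset Strict Implicit.
Unset Printing Implicit Defensive.

Import Order.TTheory GRing.Theory Num.Theory.
Import numFieldNormedType.Exports.

Local Open Scope classical_set_scope.
Local Open Scope ring_scope.

(* Restriction of scalars along phi: the carrier of M with c acting as phi c. *)
Definition restrict_scalars (K : pzRingType) (A : pzRingType)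
  (phi : {rmorphism K -> A}) (M : lmodType A) : Type := M.

Section RestrictScalars.
Variables (K A : pzRingType) (phi : {rmorphism K -> A}) (M : lmodType A).

HB.instance Definition _ := GRing.Zmodule.on (restrict_scalars phi M).

Definition restrict_scale (c : K) (m : restrict_scalars phi M) :
  restrict_scalars phi M := phi c *: (m : M).

Fact restrict_scaleA a b m :
  restrict_scale a (restrict_scale b m) = restrict_scale (a * b) m.
Proof. by rewrite /restrict_scale scalerA rmorphM. Qed.

Fact restrict_scale1 : left_id 1 restrict_scale.
Proof. by move=> m; rewrite /restrict_scale rmorph1 scale1r. Qed.

Fact restrict_scaleDr : right_distributive restrict_scale +%R.
Proof. by move=> c m m'; rewrite /restrict_scale scalerDr. Qed.

Fact restrict_scaleDl m : {morph restrict_scale^~ m : a b / a + b}.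
Proof. by move=> a b; rewrite /restrict_scale rmorphD scalerDl. Qed.

HB.instance Definition _ :=
  GRing.Zmodule_isLmodule.Build K (restrict_scalars phi M)
    restrict_scaleA restrict_scale1 restrict_scaleDr restrict_scaleDl.
End RestrictScalars.

Section Tensor.
Variables (A B : comNzRingType) (phi : {rmorphism A -> B}) (M : lmodType A).

Local Notation F := {freeg (M * B)%type / A}.
Local Notation gen m b := (<< ((m, b) : (M * B)%type) >> : F).

Definition tensor_relations : set F :=
  [set x | (exists m m' b, x = gen (m + m') b - gen m b - gen m' b)
        \/ (exists m b b', x = gen m (b + b') - gen m b - gen m b')
        \/ (exists a m b, x = gen (a *: m) b - a *: gen m b)
        \/ (exists a m b, x = gen m (phi a * b) - a *: gen m b)].


Definition tensor_null : {pred F} := fun x =>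
  `[< forall S : {pred F}, submod_closed S ->
        (forall y, tensor_relations y -> y \in S) -> x \in S >].

Fact tensor_nullP x :
  reflect (forall S : {pred F}, submod_closed S ->
             (forall y, tensor_relations y -> y \in S) -> x \in S)
          (x \in tensor_null).
Proof. exact: asboolP. Qed.

Fact tensor_null_submod_closed : submod_closed tensor_null.
Proof.
split=> [|a x y /tensor_nullP xN /tensor_nullP yN]; apply/tensor_nullP.
  by move=> S [].
by move=> S Ssub Srel; have [_] := Ssub; apply; [exact: xN|exact: yN].
Qed.

HB.instance Definition _ :=
  GRing.isSubmodClosed.Build A F tensor_null tensor_null_submod_closed.

Fact tensor_null_rel x : tensor_relations x -> x \in tensor_null.
Proof. by move=> xrel; apply/tensor_nullP => S _; apply. Qed.

(* M (x)_A B, where B is an A-module through phi: the free A-module on M * B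
   modulo the submodule generated by the bilinearity relations. *)
Definition base_change : Type := Quotient.quot tensor_null.
HB.instance Definition _ := GRing.Zmodule.on base_change.

(* B acts on the right factor of the tensor product. *)
Definition free_act (c : B) (x : F) : F :=
  fglift (fun p : (M * B)%type => gen p.1 (c * p.2)) x.

Fact fgliftB (V : lmodType A) (f : M * B -> V) (x y : F) :
  fglift f (x - y) = fglift f x - fglift f y.
Proof. exact: lift_is_additive. Qed.

Fact fglift0 (V : lmodType A) (f : M * B -> V) : fglift f (0 : F) = 0.
Proof. by rewrite -(subrr 0) fgliftB subrr. Qed.

Fact fgliftD (V : lmodType A) (f : M * B -> V) (x y : F) :
  fglift f (x + y) = fglift f x + fglift f y.
Proof. by rewrite -{1}(opprK y) -{1}(sub0r y) !fgliftB fglift0 sub0r opprK. Qed.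

Fact freegUE (a : A) (p : M * B) : (<< a *g p >> : F) = a *: << p >>.
Proof. by apply/eqP/freeg_eqP => q; rewrite coeffZ !coeffU mul1r. Qed.

Fact free_ind (P : F -> Prop) : P 0 -> (forall x y, P x -> P y -> P (x + y)) ->
  (forall a m b, P (a *: gen m b)) -> forall x, P x.
Proof.
move=> P0 PD Pg x; rewrite -(freeg_sumE x).
by apply: (big_ind P) => // -[m b] _; rewrite freegUE.
Qed.

Fact fglift_gen (V : lmodType A) (f : M * B -> V) (a : A) m b :
  fglift f (a *: gen m b) = a *: f (m, b).
Proof. by rewrite -freegUE liftU. Qed.

Fact fgliftZ (V : lmodType A) (f : M * B -> V) (a : A) (x : F) :
  fglift f (a *: x) = a *: fglift f x.
Proof.
elim/free_ind: x => [|x y IHx IHy|a' m b]; first by rewrite scaler0 fglift0 scaler0.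
  by rewrite scalerDr !fgliftD scalerDr IHx IHy.
by rewrite scalerA !fglift_gen scalerA.
Qed.

Fact free_actD c x y : free_act c (x + y) = free_act c x + free_act c y.
Proof. exact: fgliftD. Qed.
Fact free_actB c x y : free_act c (x - y) = free_act c x - free_act c y.
Proof. exact: fgliftB. Qed.
Fact free_actZ c a x : free_act c (a *: x) = a *: free_act c x.
Proof. exact: fgliftZ. Qed.
Fact free_act0 c : free_act c 0 = 0.
Proof. exact: fglift0. Qed.
Fact free_act_gen c m b : free_act c (gen m b) = gen m (c * b).
Proof. by rewrite -[gen m b]scale1r /free_act fglift_gen scale1r. Qed.

Fact free_act_null c x : x \in tensor_null -> free_act c x \in tensor_null.
Proof.
move=> /tensor_nullP xN.
apply: (xN (fun y => free_act c y \in tensor_null)).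
  split=> [|a u v uN vN]; rewrite unfold_in; first by rewrite free_act0 rpred0.
  by rewrite free_actD free_actZ rpredD ?rpredZ.
move=> y yrel; rewrite unfold_in; apply: tensor_null_rel.
case: yrel => [[m [m' [b ->]]]|[[m [b [b' ->]]]|[[a [m [b ->]]]|[a [m [b ->]]]]]].
- by rewrite !free_actB !free_act_gen; left; exists m, m', (c * b).
- by rewrite !free_actB !free_act_gen mulrDr; right; left; exists m, (c * b), (c * b').
- rewrite free_actB free_actZ !free_act_gen.
  by right; right; left; exists a, m, (c * b).
- rewrite free_actB free_actZ !free_act_gen mulrCA.
  by right; right; right; exists a, m, (c * b).
Qed.

Fact free_actA c d x : free_act c (free_act d x) = free_act (c * d) x.
Proof.
elim/free_ind: x => [|x y IHx IHy|a m b]; first by rewrite !free_act0.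
  by rewrite !free_actD IHx IHy.
by rewrite !free_actZ !free_act_gen mulrA.
Qed.

Fact free_act1 x : free_act 1 x = x.
Proof.
elim/free_ind: x => [|x y IHx IHy|a m b]; first by rewrite !free_act0.
  by rewrite !free_actD IHx IHy.
by rewrite !free_actZ !free_act_gen mul1r.
Qed.

Fact free_actDl c d x :
  free_act (c + d) x - (free_act c x + free_act d x) \in tensor_null.
Proof.
elim/free_ind: x => [|x y IHx IHy|a m b]; first by rewrite !free_act0 addr0 subr0 rpred0.
  by rewrite !free_actD [X in _ - X]addrACA opprD addrACA rpredD.
rewrite !free_actZ !free_act_gen -scalerDr -scalerBr rpredZ//.
apply: tensor_null_rel; right; left; exists m, (c * b), (d * b).
by rewrite mulrDl opprD addrA.
Qed.

Local Notation proj := (\pi_(Quotient.quot tensor_null)%qT : F -> base_change).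

Definition base_change_scale (c : B) (x : base_change) : base_change :=
  proj (free_act c (repr (x : Quotient.quot tensor_null))).

Fact proj_eq (x y : F) : x - y \in tensor_null -> proj x = proj y.
Proof. by rewrite Quotient.idealrBE => /eqP. Qed.

Fact projD (x y : F) : proj (x + y) = proj x + proj y.
Proof. exact: Quotient.pi_add. Qed.

Fact base_changeP (x : base_change) : exists y, x = proj y.
Proof. by exists (repr (x : Quotient.quot tensor_null)); rewrite reprK. Qed.

Fact base_change_scaleE c x :
  base_change_scale c (proj x) = proj (free_act c x).
Proof.
apply: proj_eq; rewrite -free_actB free_act_null//.
by rewrite Quotient.idealrBE reprK.
Qed.

Fact base_change_scaleA c d x :
  base_change_scale c (base_change_scale d x) = base_change_scale (c * d) x.
Proof. by case: (base_changeP x) => y ->; rewrite !base_change_scaleE free_actA. Qed.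

Fact base_change_scale1 : left_id 1 base_change_scale.
Proof. by move=> x; case: (base_changeP x) => y ->; rewrite base_change_scaleE free_act1. Qed.

Fact base_change_scaleDr : right_distributive base_change_scale +%R.
Proof.
move=> c x x'; case: (base_changeP x) (base_changeP x') => [y ->] [y' ->].
by rewrite -projD !base_change_scaleE free_actD projD.
Qed.

Fact base_change_scaleDl x : {morph base_change_scale^~ x : c d / c + d}.
Proof.
move=> c d; case: (base_changeP x) => y ->.
by rewrite !base_change_scaleE -projD; apply: proj_eq; exact: free_actDl.
Qed.

HB.instance Definition _ :=
  GRing.Zmodule_isLmodule.Build B base_change
    base_change_scaleA base_change_scale1 base_change_scaleDr base_change_scaleDl.

End Tensor.

Section Dimension.
Variables (K : fieldType) (V : lmodType K).

Definition has_dim (S : set V) (d : nat) : Prop :=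
  exists b : 'I_d -> V, (forall i, S (b i)) /\
    forall v, S v -> exists! c : {ffun 'I_d -> K}, v = \sum_i c i *: b i.

Definition finite_dim (S : set V) : Prop := exists d, has_dim S d.

(* 0 when S is infinite-dimensional. *)
Definition vdim (S : set V) : nat := xget 0%N [set d | has_dim S d].

End Dimension.

Section CommutativeAlgebra.
Variables (k : fieldType) (A : idomainType) (iota : {rmorphism k -> A}).
Variable (M : lmodType A).

Definition prime_chain (d : nat) : Prop :=
  exists P : 'I_d.+1 -> {pred A},
    (forall i, idealr_closed (P i) /\ prime_idealr_closed (P i)) /\
    (forall i j : 'I_d.+1, (i < j)%N ->
       {subset P i <= P j} /\ ~ {subset P j <= P i}).

Definition krull_dim (d : nat) : Prop :=
  prime_chain d /\ forall e, prime_chain e -> (e <= d)%N.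

Definition fg_algebra : Prop :=
  exists s : seq A, forall S : {pred A}, subring_closed S ->
    (forall c, iota c \in S) -> {subset s <= S} -> forall a, a \in S.

Definition fg_module : Prop :=
  exists d (g : 'I_d -> M), forall m, exists c : 'I_d -> A, m = \sum_i c i *: g i.

Definition module_rank : nat :=
  vdim [set: base_change (@FracField.tofrac A : {rmorphism A -> {fraction A}}) M].

End CommutativeAlgebra.

Section Graded.
Variables (R : realType).

(* The empty combination puts 0 in Gamma: a graded ring has 1 in degree 0. *)
Definition fg_submonoid (Gamma : set R) : Prop :=
  exists s : seq R,
    Gamma = [set \sum_(i < size s) s`_i *+ c i | c in [set: 'I_(size s) -> nat]].

(* Finitely supported choices of homogeneous components. *)
Definition homogeneous_family (V : zmodType) (G : R -> set V) : set (R -> V) :=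
  [set f | (forall l, G l (f l)) /\ finite_set [set l | f l != 0]].

Definition direct_sum (V : zmodType) (G : R -> set V) : Prop :=
  (forall l, G l 0 /\ forall u v, G l u -> G l v -> G l (u - v)) /\
  forall v, exists! f, homogeneous_family G f /\ v = \sum_(l \in [set: R]) f l.

Definition graded_ring (A : pzRingType) (GA : R -> set A) : Prop :=
  [/\ direct_sum GA, GA 0 1 &
      forall g h a b, GA g a -> GA h b -> GA (g + h) (a * b)].

Definition graded_module (A : pzRingType) (GA : R -> set A) (M : lmodType A)
    (GM : R -> set M) : Prop :=
  direct_sum GM /\
  forall g l a m, GA g a -> GM l m -> GM (g + l) (a *: m).

Definition truncation (V : zmodType) (G : R -> set V) (x : R) : set V :=
  [set \sum_(l \in [set l | l <= x]) f l | f in homogeneous_family G].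

Variables (k : fieldType) (A : idomainType) (iota : {rmorphism k -> A}).

Definition hilbert_fun (M : lmodType A) (GM : R -> set M) (x : R) : R :=
  (vdim (truncation GM x : set (restrict_scalars iota M)))%:R.

(* a is the constant of index n and a' the one of index n - 1, for n >= 1. Both
   are determined by GM, which is why they can be given by a relation. *)
Definition hilbert_constants (n : nat) (M : lmodType A) (GM : R -> set M)
    (a a' : R) : Prop :=
  (exists C : R, \forall x \near +oo,
     `|hilbert_fun GM x - a / n`!%:R * x ^+ n| <= C * `|x ^+ n.-1|) /\
  (T ^- n * \int[lebesgue_measure]_(x in `[1, T])
     (hilbert_fun GM x - a / n`!%:R * x ^+ n - a' / (n.-1)`!%:R * x ^+ n.-1))
     @[T --> +oo] --> (0 : R).

End Graded.

(* Main.v *)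
Require Import Defs.
From mathcomp Require Import all_boot all_order all_algebra.
From mathcomp Require Import all_classical all_reals all_analysis.
From mathcomp.multinomials Require Import freeg.
From mathcomp Require Import zify ring lra.

Import Order.TTheory GRing.Theory Num.Theory.
Import numFieldNormedType.Exports.
Local Open Scope classical_set_scope.
Local Open Scope ring_scope.

Set Implicit Arguments.
Unset Strict Implicit.
Unset Printing Implicit Defensive.

(** Write A = k[y_1, ..., y_N] with homogeneous generators y_i of positive degrees
    gam_i, and order the monomials by degree, ties being broken
    lexicographically. For a homogeneous ideal I call a monomial standard if it
    is not a combination of smaller monomials modulo I. The standard monomials
    of degree at most x form a basis of the part of A/I of degree at most x, and
    their exponents form a down-set D of N^N. So the Hilbert function f_I of A/I
    counts the points of D of degree at most x. No homogeneous Noether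
    normalization is available for incommensurable degrees, but the counting
    function of a down-set can be analysed directly.

    Growth. By Dickson's lemma the slices of D along one variable stabilise, so D
    is built from down-sets in fewer variables by finitely many translations and
    by cylinders, whose counting functions f' satisfy
    f' x = f x + f' (x - gam_i) with f known. Carrying along a primitive F of f,
    which satisfies the same recurrence, one sees by induction that f is a
    polynomial of some exact degree d up to O(x ^ (d - 1)), and that F is a
    polynomial of degree d + 1 up to O(x ^ (d - 1)) (cumul_polylike). The first
    fact is the leading term of the Hilbert function and the second one its
    second term on average (expansion_constants). Counting functions are
    nonnegative, so that leading terms never cancel.

    Dimension. The order of growth of A is at most the Krull dimension
    (below_krull_dim): among the homogeneous ideals containing p + (y), with p a
    prime and y a generator outside p, a maximal one whose quotient has growth
    at least one less than that of A/p is prime, by the exact sequence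
    A/(J : a) -> A/J -> A/(J + (a)), so a large growth yields a long chain of
    primes (growth_step).

    Modules. If M is generated by homogeneous g_1, ..., g_r of degrees e_i, and
    I_i is the ideal of the a such that a g_i lies in the span of the later
    generators, then the Hilbert function of M is the sum of the translates
    f_(I_i) (x - e_i) (hilbert_fun_mod_sum). For I_i <> 0 the corresponding term
    is O(x ^ (n - 1)), as it is bounded by f_0 x - f_0 (x - d), where d is the
    degree of a nonzero homogeneous element of I_i; so the leading coefficient
    of M is that of A times the number of the i with I_i = 0
    (mod_sum_expansion). These g_i are a maximal independent family, hence give
    a basis of M tensored with the fraction field, and their number is the rank
    of M (free_generators, module_rank_free). *)

(** * Exponent vectors *)

(** Nested pairs make the slices of a set of exponents along its last variable,
    which comes first in the pair, sets of exponents in one variable less. *)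
Fixpoint expo (N : nat) : choiceType :=
  if N is N'.+1 then (nat * expo N')%type : choiceType else unit.

#[local] Arguments expo : simpl never.

Fixpoint expo_zero (N : nat) : expo N :=
  if N is N'.+1 then (0%N, expo_zero N') else tt.

Fixpoint expo_add (N : nat) : expo N -> expo N -> expo N :=
  if N is N'.+1 then fun s t => ((s.1 + t.1)%N, expo_add s.2 t.2)
  else fun _ _ => tt.

Fixpoint expo_le (N : nat) : rel (expo N) :=
  if N is N'.+1 then fun s t => (s.1 <= t.1)%N && expo_le s.2 t.2
  else fun _ _ => true.

Fixpoint expo_lex (N : nat) : rel (expo N) :=
  if N is N'.+1 then
    fun s t => (s.1 < t.1)%N || (s.1 == t.1) && expo_lex s.2 t.2
  else fun _ _ => false.

Definition expo_cons (N : nat) (j : nat) (t : expo N) : expo N.+1 := (j, t).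

Definition expo_up (N : nat) (t : expo N.+1) : expo N.+1 := (t.1.+1, t.2).

Definition bottom_slice (N : nat) (D : set (expo N.+1)) : set (expo N) :=
  [set t | D (expo_cons 0 t)].

Definition lowered (N : nat) (D : set (expo N.+1)) : set (expo N.+1) :=
  [set t | D (expo_up t)].

Lemma expo_leP N (s t : expo N) :
  expo_le s t -> exists u, t = expo_add u s.
Proof.
elim: N s t => [[] []|N IH [i s] [j t]] /=; first by exists tt.
move=> /andP[ij /IH[u ->]]; exists ((j - i)%N, u) => /=; by rewrite subnK.
Qed.

Lemma expo_le_refl N (s : expo N) : expo_le s s.
Proof. by elim: N s => [[]|N IH [i s]] //=; rewrite leqnn IH. Qed.

Lemma expo_lex_irr N (s : expo N) : expo_lex s s = false.
Proof. by elim: N s => [[]|N IH [i s]] //=; rewrite ltnn eqxx IH. Qed.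

Lemma expo_lex_trans N : transitive (@expo_lex N).
Proof.
elim: N => [|N IH] //= [j t] [i s] [l u] /=.
move=> /orP[ij|/andP[/eqP-> st]] /orP[jl|/andP[/eqP<- tu]].
- by rewrite (ltn_trans ij jl).
- by rewrite ij.
- by rewrite jl.
- by rewrite eqxx (IH _ _ _ st tu) orbT.
Qed.

Lemma expo_lex_total N (s t : expo N) : [|| s == t, expo_lex s t | expo_lex t s].
Proof.
elim: N s t => [[] []|N IH [i s] [j t]] //=.
case: (ltngtP i j) => [||->]; rewrite ?orbT//= xpair_eqE eqxx /=; exact: IH.
Qed.

Lemma expo_lex_add N (u s t : expo N) :
  expo_lex (expo_add u s) (expo_add u t) = expo_lex s t.
Proof.
elim: N u s t => [|N IH] //= [l u] [i s] [j t] /=.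
by rewrite ltn_add2l eqn_add2l IH.
Qed.

(** Each index is chosen to be a minimum of the tail of the sequence that follows
    the index chosen before. *)
Lemma nat_nondecr_subseq (a : nat -> nat) :
  exists2 phi : nat -> nat, {homo phi : i j / (i < j)%N} &
    {homo (a \o phi) : i j / (i <= j)%N}.
Proof.
have minafter m : exists l, (m <= l)%N /\ forall l', (m <= l')%N -> (a l <= a l')%N.
  have ex : exists v, `[< exists l, (m <= l)%N /\ a l = v >].
    by exists (a m); apply/asboolP; exists m.
  case: (ex_minnP ex) => v /asboolP[l [ml alv]] vmin.
  exists l; split=> // l' ml'; rewrite alv; apply: vmin.
  by apply/asboolP; exists l'.
have [nxt nxtP] := choice minafter.
pose phi := fix phi i := if i is i'.+1 then nxt (phi i').+1 else nxt 0%N.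
have phiS i : (phi i < phi i.+1)%N by have [] := nxtP (phi i).+1.
have phi_lt : {homo phi : i j / (i < j)%N}.
  by apply: homo_ltn => // y x z; apply: ltn_trans.
exists phi => //; apply: homo_leq => [//|y x z|i /=]; first exact: leq_trans.
case: i => [|i] /=; first by have [_] := nxtP 0%N; apply.
have [le1 min1] := nxtP (phi i).+1; apply: min1; apply: leq_trans le1 _.
exact: ltnW (phiS i.+1).
Qed.

(** Dickson's lemma: extract subsequences one coordinate at a time. *)
Lemma dickson N (a : nat -> expo N) :
  exists2 phi : nat -> nat, {homo phi : i j / (i < j)%N} &
    forall i j, (i <= j)%N -> expo_le (a (phi i)) (a (phi j)).
Proof.
elim: N a => [|N IH] a; first by exists id.
have [phi philt phi1] := nat_nondecr_subseq (fst \o a).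
have [psi psilt psi2] := IH (snd \o a \o phi).
exists (phi \o psi); first by move=> i j ij /=; apply/philt/psilt.
have psile i j : (i <= j)%N -> (psi i <= psi j)%N.
  by rewrite leq_eqVlt => /orP[/eqP->//|/psilt/ltnW].
by move=> i j ij /=; rewrite psi2 // andbT; apply/phi1/psile.
Qed.

Definition downset N (D : set (expo N)) : Prop :=
  forall s t, expo_le s t -> D t -> D s.

(** Otherwise there are indices J_0 <= J_1 <= ... and exponents t_i in D (J_i)
    outside D (J_(i+1)). By Dickson's lemma t_i <= t_j for some i < j, and then
    t_i lies in D (J_j), which is contained in D (J_(i+1)). *)
Lemma downset_dcc N (D : nat -> set (expo N)) :
  (forall i, downset (D i)) -> (forall i j, (i <= j)%N -> D j `<=` D i) ->
  exists J, forall i, (J <= i)%N -> D i = D J.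
Proof.
move=> Ddown Ddecr; apply: contrapT => /forallNP nostab.
have witness J : exists p : nat * expo N, [/\ (J <= p.1)%N, D J p.2 & ~ D p.1 p.2].
  have /existsNP[i /not_implyP[Ji Dne]] := nostab J.
  have [t Dt nDt] : exists2 t, D J t & ~ D i t.
    apply: contrapT => nt; apply: Dne; apply/seteqP; split; first exact: Ddecr.
    by move=> t Dt; apply: contrapT => nDt; apply: nt; exists t.
  by exists (i, t).
have [w wP] := choice witness.
pose J := fix J i := if i is i'.+1 then (w (J i')).1 else 0%N.
have Jle : {homo J : i j / (i <= j)%N}.
  apply: homo_leq => [//|y x z|i /=]; first exact: leq_trans.
  by have [] := wP (J i).
have [phi philt phile] := dickson (fun i => (w (J i)).2).
have [_ _ nD] := wP (J (phi 0%N)); apply: nD.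
apply: Ddown (phile 0%N 1%N isT) _.
apply: (Ddecr (J (phi 0%N).+1) (J (phi 1%N))); first exact/Jle/philt.
by have [] := wP (J (phi 1%N)).
Qed.

Section Enumeration.
Variables (R : realType) (gam : nat -> R).
Hypothesis gam_gt0 : forall i, 0 < gam i.

Fixpoint deg (N : nat) : expo N -> R :=
  if N is N'.+1 then fun t => gam N' *+ t.1 + deg t.2 else fun _ => 0.

Lemma deg_ge0 N (t : expo N) : 0 <= deg t.
Proof.
elim: N t => [|N IH] //= [j t] /=; apply: addr_ge0 => //.
by apply: mulrn_wge0; apply: ltW.
Qed.

Lemma deg_add N (s t : expo N) : deg (expo_add s t) = deg s + deg t.
Proof.
by elim: N s t => [|N IH] /= s t; rewrite ?addr0// IH mulrnDr addrACA.
Qed.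

(** Beyond the given bound on the first exponent the recursive call returns the
    empty list. *)
Fixpoint expos (N : nat) : R -> seq (expo N) :=
  if N is N'.+1 then fun x =>
    [seq (j, t) | j <- iota 0 (Num.truncn (x / gam N')).+1,
                  t <- @expos N' (x - gam N' *+ j)]
  else fun x => if 0 <= x then [:: tt] else [::].

Lemma mem_expos N x (t : expo N) : (t \in expos N x) = (deg t <= x).
Proof.
elim: N x t => [|N IH] x /=; first by case; case: ifP.
case=> j t /=.
apply/(@allpairsPdep nat (fun=> expo N) (expo N.+1) (fun j t => (j, t))
  (iota 0 (Num.truncn (x / gam N)).+1) (fun j => expos N (x - gam N *+ j)) (j, t))/idP
  => [[j' [t' [_ /=]]]|le_x].
  by rewrite IH => le_x [-> ->]; rewrite -lerBrDl.
exists j, t; split => //; last by rewrite IH lerBrDl.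
rewrite mem_iota add0n ltnS leq0n /=.
have le_j : gam N *+ j <= x by apply: le_trans le_x; rewrite lerDl deg_ge0.
have x0 : 0 <= x by apply: le_trans le_j; rewrite mulrn_wge0 // ltW.
rewrite truncn_ge_nat; last by rewrite divr_ge0 // ltW.
by rewrite ler_pdivlMr // mulr_natl.
Qed.

Lemma expos_uniq N x : uniq (expos N x).
Proof.
elim: N x => [|N IH] x /=; first by case: ifP.
apply: (@allpairs_uniq_dep nat (fun=> expo N) (expo N.+1) (fun j t => (j, t))
  (iota 0 (Num.truncn (x / gam N)).+1) (fun j => expos N (x - gam N *+ j))).
- exact: iota_uniq.
- by move=> j _; exact: IH.
- by move=> [j t] [j' t'] _ _ /= [-> ->].
Qed.

#[local] Arguments expos : simpl never.

(** Counting functions of a set of exponents; u is 1 for the number of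
    elements of degree at most x, and the identity for its primitive. *)
Definition cumul_sum (u : R -> R) N (D : set (expo N)) (x : R) : R :=
  \sum_(t <- expos N x | `[< D t >]) u (x - deg t).

Lemma cumul_sum0 u N (x : R) : x < 0 -> forall D : set (expo N), cumul_sum u D x = 0.
Proof.
move=> x0 D; rewrite /cumul_sum big_seq_cond big1 // => t /andP[].
by rewrite mem_expos => /(le_trans (deg_ge0 t)); rewrite leNgt x0.
Qed.

Lemma expo_cons_inj N j : injective (@expo_cons N j).
Proof. by move=> s t [->]. Qed.

Lemma expo_up_inj N : injective (@expo_up N).
Proof. by move=> [i s] [j t] [-> ->]. Qed.

Lemma expo_cons_or_up N (t : expo N.+1) :
  (exists s, t = expo_cons 0 s) \/ (exists s, t = expo_up s).
Proof.
case: t => [[|j] t]; first by left; exists t.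
by right; exists (expo_cons j t).
Qed.

Lemma expo_up_notin N (t : expo N.+1) s : expo_up t \notin [seq expo_cons 0 t' | t' <- s].
Proof. by apply/negP => /mapP[]. Qed.

Lemma expo_cons_notin N (t : expo N) s : expo_cons 0 t \notin [seq expo_up t' | t' <- s].
Proof. by apply/negP => /mapP[]. Qed.

Lemma deg_cons N (t : expo N) : deg (expo_cons 0 t) = deg t.
Proof. by rewrite /= mulr0n add0r. Qed.

Lemma deg_up N (t : expo N.+1) : deg (expo_up t) = gam N + deg t.
Proof. by rewrite /= mulrS addrA. Qed.

(** The recursion behind all growth estimates. *)
Lemma cumul_sum_split u N (D : set (expo N.+1)) x :
  cumul_sum u D x = cumul_sum u (bottom_slice D) x + cumul_sum u (lowered D) (x - gam N).
Proof.
have -> : cumul_sum u D x =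
  \sum_(t <- [seq expo_cons 0 t | t <- expos N x] ++
             [seq expo_up p | p <- expos N.+1 (x - gam N)] | `[< D t >])
    u (x - deg t).
  apply: perm_big; apply: uniq_perm.
  - exact: expos_uniq.
  - rewrite cat_uniq (map_inj_uniq (@expo_cons_inj _ _)) (map_inj_uniq (@expo_up_inj _)).
    rewrite !expos_uniq andbT; apply/hasPn => _ /mapP[t _ ->]; exact: expo_up_notin.
  - move=> t; rewrite mem_expos mem_cat; case: (expo_cons_or_up t) => -[s ->].
      rewrite (mem_map (@expo_cons_inj _ _)) (negbTE (expo_cons_notin _ _)) orbF.
      by rewrite mem_expos deg_cons.
    rewrite (mem_map (@expo_up_inj _)) (negbTE (expo_up_notin _ _)).
    by rewrite mem_expos deg_up lerBrDl.
rewrite big_cat !big_map; congr (_ + _).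
  by apply: eq_bigr => t _; rewrite deg_cons.
by apply: eq_bigr => t _; rewrite deg_up opprD addrA.
Qed.

Lemma cumul_sum_ge0 u N (D : set (expo N)) x :
  (forall y, 0 <= y -> 0 <= u y) -> 0 <= cumul_sum u D x.
Proof.
move=> u0; rewrite /cumul_sum big_seq_cond sumr_ge0 // => t /andP[].
by rewrite mem_expos => tx _; apply: u0; rewrite subr_ge0.
Qed.

Lemma cumul_sum_widen u N (D : set (expo N)) x T : x <= T ->
  cumul_sum u D x = \sum_(t <- expos N T | `[< D t >] && (deg t <= x)) u (x - deg t).
Proof.
move=> xT; rewrite /cumul_sum.
rewrite -[LHS]big_filter -[RHS]big_filter; apply: perm_big; apply: uniq_perm.
- by rewrite filter_uniq // expos_uniq.
- by rewrite filter_uniq // expos_uniq.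
- move=> t; rewrite !mem_filter !mem_expos -andbA; congr (_ && _).
  by case: leP => //= tx; rewrite (le_trans tx xT).
Qed.

Lemma cumul_sum_homo u N (D : set (expo N)) :
  (forall y, 0 <= y -> 0 <= u y) -> {homo u : x y / x <= y} ->
  {homo cumul_sum u D : x y / x <= y}.
Proof.
move=> u0 umono x y xy; rewrite (cumul_sum_widen _ _ xy) /cumul_sum.
rewrite [leRHS]big_mkcond [leLHS]big_mkcond [leLHS]big_seq [leRHS]big_seq /=; apply: ler_sum => t.
rewrite mem_expos => ty; case: asboolP => //= Dt; case: ifP => tx.
  by apply: umono; rewrite lerD2r.
by apply: u0; rewrite subr_ge0.
Qed.

End Enumeration.

(** * Orders of growth *)

Section Asymptotics.
Variable R : realType.
Implicit Types (f F h u : R -> R) (p q : {poly R}) (n m : nat) (x y : R).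

(** This is O(x ^ (n - 1)), except that the factor n makes it mean eventually zero
    when n = 0. With this convention the case of constant growth, in which the
    error term of an expansion has to vanish, is like all others. *)
Definition below n h : Prop :=
  exists C x0, forall x, x0 <= x -> `|h x| <= C * (n%:R * x ^+ n.-1).

Lemma gauge_ge0 n x : 1 <= x -> 0 <= n%:R * x ^+ n.-1.
Proof. by move=> x1; rewrite mulr_ge0 // exprn_ge0 //; lra. Qed.

Lemma gauge_le n m x : (n <= m)%N -> 1 <= x ->
  n%:R * x ^+ n.-1 <= m%:R * x ^+ m.-1.
Proof.
move=> nm x1; apply: ler_pM => //; first by rewrite exprn_ge0 //; lra.
  by rewrite ler_nat.
by apply: ler_weXn2l => //; lia.
Qed.

Lemma belowP n h : below n h -> exists C x0,
  [/\ 0 <= C, 1 <= x0 & forall x, x0 <= x -> `|h x| <= C * (n%:R * x ^+ n.-1)].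
Proof.
move=> [C [x0 hC]]; exists `|C|, (Num.max 1 x0); split=> //.
  by rewrite le_max lexx.
move=> x; rewrite ge_max => /andP[x1 /hC hx]; apply: le_trans hx _.
by rewrite ler_wpM2r ?gauge_ge0 // ler_norm.
Qed.

Lemma below_le n h u x1 : (forall x, x1 <= x -> `|h x| <= `|u x|) ->
  below n u -> below n h.
Proof.
move=> hu /belowP[C [x0 [C0 x01 uC]]]; exists C, (Num.max x1 x0) => x.
by rewrite ge_max => /andP[/hu /le_trans + /uC]; apply.
Qed.

Lemma below_add n h u : below n h -> below n u -> below n (fun x => h x + u x).
Proof.
move=> [C [x0 hC]] [C' [x0' hC']]; exists (C + C'), (Num.max x0 x0') => x.
rewrite ge_max => /andP[/hC hx /hC' ux]; apply: le_trans (ler_normD _ _) _.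
by rewrite mulrDl lerD.
Qed.

Lemma below_sub n h u : below n h -> below n u -> below n (fun x => h x - u x).
Proof.
move=> hh hu; apply: (below_add hh); apply: (below_le (x1 := 0) _ hu) => x _.
by rewrite normrN.
Qed.

Lemma below_mono n m h : (n <= m)%N -> below n h -> below m h.
Proof.
move=> nm /belowP[C [x0 [C0 x01 hC]]]; exists C, x0 => x xx0.
apply: le_trans (hC x xx0) _; apply: ler_wpM2l => //.
by apply: gauge_le => //; exact: le_trans xx0.
Qed.

Lemma below_poly n p : (size p <= n)%N -> below n (horner p).
Proof.
case: n => [|n] sp.
  by exists 0, 0 => x _; move: sp; rewrite leqn0 size_poly_eq0 => /eqP->;
    rewrite horner0 normr0 mul0r.
exists (\sum_(i < size p) `|p`_i|), 1 => x x1.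
rewrite horner_coef; apply: le_trans (ler_norm_sum _ _ _) _.
rewrite mulr_suml; apply: ler_sum => i _; rewrite normrM ler_wpM2l //.
have x0 : 0 <= x by lra.
rewrite normrX ger0_norm //=; apply: (@le_trans _ _ (x ^+ n)).
  by apply: ler_weXn2l => //; exact: leq_trans (ltn_ord i) sp.
by rewrite -[leLHS]mul1r ler_wpM2r ?exprn_ge0 // ler1n.
Qed.

Lemma below_shift n h g : below n h -> below n (fun x => h (x - g)).
Proof.
move=> /belowP[C [x0 [C0 x01 hC]]].
exists (C * 2 ^+ n.-1), (x0 + `|g|) => x xx0.
have g1 := ler_norm g; have g2 := ler_norm (- g); rewrite normrN in g2.
have xg : x0 <= x - g by lra.
apply: le_trans (hC _ xg) _.
rewrite -!mulrA; apply: ler_wpM2l => //; rewrite mulrCA; apply: ler_wpM2l => //.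
by rewrite -exprMn; apply: lerXn2r; rewrite ?nnegrE; lra.
Qed.

Lemma size_sub_top n p : (size p <= n.+1)%N -> (size (p - p`_n *: 'X^n)%R <= n)%N.
Proof.
move=> sp; apply/leq_sizeP => j; rewrite leq_eqVlt coefB coefZ coefXn.
case/orP => [/eqP<-|nj]; first by rewrite eqxx mulr1 subrr.
by rewrite gtn_eqF // mulr0 subr0; move/leq_sizeP: sp; apply.
Qed.

(** A polynomial of degree at most n that grows more slowly than x ^ n has no
    term of degree n. *)
Lemma below_coef0 n p : (size p <= n.+1)%N -> below n (horner p) -> p`_n = 0.
Proof.
move=> sp hp; apply: contrapT => /eqP pn0.
have : below n (horner (p`_n *: 'X^n)).
  have -> : horner (p`_n *: 'X^n) = fun x => p.[x] - (p - p`_n *: 'X^n).[x].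
    by apply/funext => x; rewrite -hornerN -hornerD opprB addrCA subrr addr0.
  by apply: below_sub => //; apply: below_poly; exact: size_sub_top.
move=> /belowP[C [x0 [C0 x01 hC]]].
pose x := Num.max x0 (C * n%:R / `|p`_n| + 1).
have xx0 : x0 <= x by rewrite /x le_max lexx.
have x1 : 1 <= x by apply: le_trans xx0.
have := hC x xx0; rewrite hornerZ hornerXn normrM [`|x ^+ n|]ger0_norm; last first.
  by rewrite exprn_ge0 //; lra.
apply/negP; rewrite -ltNge.
case: n {sp hp hC} pn0 @x xx0 x1 => [|n] pn0 x xx0 x1.
  by rewrite mul0r mulr0 expr0 mulr1 normr_gt0.
rewrite exprS !mulrA ltr_pM2r; last by rewrite exprn_gt0 //; lra.
rewrite -ltr_pdivrMl ?normr_gt0 // mulrC; apply: (@lt_le_trans _ _ (C * n.+1%:R / `|p`_n.+1| + 1)).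
  by rewrite ltrDl.
by rewrite /x le_max lexx orbT.
Qed.

Definition locally_bounded h := forall b, exists B, forall y, `|y| <= b -> `|h y| <= B.

Lemma locally_bounded_poly p : locally_bounded (horner p).
Proof.
move=> b; elim/poly_ind: p => [|p c [B hB]].
  by exists 0 => y _; rewrite horner0 normr0.
exists (B * b + `|c|) => y yb; rewrite hornerMXaddC.
by apply: le_trans (ler_normD _ _) _; rewrite lerD // normrM ler_pM // hB.
Qed.

Lemma locally_bounded_sub h u :
  locally_bounded h -> locally_bounded u -> locally_bounded (fun x => h x - u x).
Proof.
move=> hh hu b; have [B hB] := hh b; have [B' hB'] := hu b.
exists (B + B') => y yb; apply: le_trans (ler_normB _ _) _.
by rewrite lerD ?hB ?hB'.
Qed.

Lemma locally_bounded_homo h :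
  (forall x, 0 <= h x) -> {homo h : x y / x <= y} -> locally_bounded h.
Proof.
move=> h0 hle b; exists (h b) => y yb; rewrite ger0_norm //.
by apply: hle; apply: le_trans (ler_norm _) yb.
Qed.

(** Summing about x / g increments of size O(x ^ (n - 1)) gives O(x ^ n). *)
Lemma below_increment n h u g x1 : 0 < g -> locally_bounded h -> below n u ->
  (forall x, x1 <= x -> `|h x| <= `|h (x - g)| + `|u x|) -> below n.+1 h.
Proof.
move=> g0 hbd /belowP[C [x2 [C0 x21 uC]]] hu.
pose x0 := Num.max x1 x2.
have x01 : 1 <= x0 by rewrite /x0 le_max x21 orbT.
have [B hB] := hbd (x0 + g).
have B0 : 0 <= B by apply: le_trans (hB 0 _) => //; rewrite normr0; lra.
have step (m : nat) x : x0 <= x -> x < x0 + g * m%:R ->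
    `|h x| <= B + m%:R * (C * (n%:R * x ^+ n.-1)).
  elim: m x => [|m IH] x xx0; first by rewrite mulr0; lra.
  move=> xm; have x1' : 1 <= x by lra.
  have s0 := mulr_ge0 C0 (gauge_ge0 n x1').
  have [xg|xg] := ltP (x - g) x0.
    apply: le_trans (hB x _) _; first by rewrite ger0_norm; lra.
    by rewrite lerDl mulr_ge0.
  apply: le_trans (hu x _) _.
    by apply: le_trans xx0; rewrite le_max lexx.
  have ux : `|u x| <= C * (n%:R * x ^+ n.-1).
    by apply: uC; apply: le_trans xx0; rewrite le_max lexx orbT.
  have hxg : `|h (x - g)| <= B + m%:R * (C * (n%:R * x ^+ n.-1)).
    apply: le_trans (IH _ xg _) _; first by rewrite mulrSr in xm; lra.
    rewrite lerD2l !mulrA; apply: ler_wpM2l; first by rewrite !mulr_ge0.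
    by apply: lerXn2r; rewrite ?nnegrE; lra.
  by rewrite mulrSr mulrDl mul1r; lra.
exists (B + C / g + C), x0 => x xx0; have x1' : 1 <= x by lra.
have m_gt := truncnS_gt (x / g).
have m_le : (Num.truncn (x / g)).+1%:R <= x / g + 1.
  by rewrite mulrSr lerD2r truncn_le // divr_ge0; lra.
apply: le_trans (step (Num.truncn (x / g)).+1 x xx0 _) _.
  by move: m_gt; rewrite ltr_pdivrMr // mulrC; lra.
have xn1 : 1 <= x ^+ n by rewrite exprn_ege1.
have nx : n%:R * x ^+ n.-1 * x = n%:R * x ^+ n.
  by case: (n) => [|n']; rewrite ?mul0r // -mulrA -exprSr.
have s0 := gauge_ge0 n x1'.
have nx' : n%:R * x ^+ n.-1 <= n%:R * x ^+ n by rewrite -nx ler_peMr.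
rewrite -pred_Sn [n.+1%:R]mulrSr.
apply: (@le_trans _ _ (B * x ^+ n + (x / g + 1) * (C * (n%:R * x ^+ n.-1)))).
  apply: lerD; first by rewrite ler_peMr.
  by apply: ler_wpM2r => //; exact: mulr_ge0.
have -> : (x / g + 1) * (C * (n%:R * x ^+ n.-1)) =
          C / g * (n%:R * x ^+ n.-1 * x) + C * (n%:R * x ^+ n.-1) by ring.
rewrite nx; have Cg : 0 <= C / g by rewrite divr_ge0 //; lra.
have := ler_wpM2l C0 nx'.
have n0 : 0 <= n%:R * x ^+ n by rewrite -nx mulr_ge0 //; lra.
have t1 := mulr_ge0 B0 n0; have t2 : 0 <= C / g * x ^+ n by rewrite mulr_ge0 //; lra.
have t3 : 0 <= C * x ^+ n by rewrite mulr_ge0 //; lra.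
nra.
Qed.

(** * Translations of polynomials *)

Definition translate (g : R) p := p \Po ('X - g%:P).

Lemma horner_translate g p x : (translate g p).[x] = p.[x - g].
Proof. by rewrite horner_comp !hornerE. Qed.

Lemma size_translate g p : size (translate g p) = size p.
Proof. by rewrite size_comp_poly2 // size_XsubC. Qed.

Lemma translate_diffXn g n :
  (size ('X^n - translate g 'X^n)%R <= n)%N /\
  ('X^n - translate g 'X^n)`_n.-1 = g *+ n.
Proof.
rewrite /translate comp_Xn_poly subrXX opprB addrCA subrr addr0.
have sz (i : 'I_n) : size ('X^(n.-1 - i) * ('X - g%:P) ^+ i) = n.
  rewrite size_monicM ?monicXn //; last by rewrite expf_neq0 // polyXsubC_eq0.
  by rewrite size_polyXn size_exp_XsubC; have := ltn_ord i; lia.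
rewrite mul_polyC; split.
  apply: leq_trans (size_scale_leq _ _) _; apply: leq_trans (size_sum _ _ _) _.
  by apply/bigmax_leqP => i _; rewrite sz.
rewrite coefZ coef_sum (eq_bigr (fun=> 1)) => [|i _].
  by rewrite sumr_const card_ord mulr_natr.
rewrite -[X in _`_X.-1](sz i) -lead_coefE; apply/monicP.
by rewrite monicMl ?monicXn // monic_exp // monicXsubC.
Qed.

Lemma translate_diff g n p : (size p <= n.+1)%N ->
  (size (p - translate g p)%R <= n)%N /\ (p - translate g p)`_n.-1 = p`_n * g *+ n.
Proof.
elim: n p => [|n IH] p sp.
  rewrite (size1_polyC sp) /translate comp_polyC subrr size_poly0 coef0 mulr0n.
  by [].
pose p' := p - p`_n.+1 *: 'X^(n.+1).
have sp' : (size p' <= n.+1)%N by exact: size_sub_top.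
have -> : p - translate g p =
    (p' - translate g p') + p`_n.+1 *: ('X^(n.+1) - translate g 'X^(n.+1)).
  rewrite /translate /p' comp_polyB comp_polyZ scalerBr; set a := _ *: 'X^_.
  by set b := _ *: (_ \Po _); set c := p \Po _; ring.
have [s1 c1] := IH _ sp'; have [s2 c2] := translate_diffXn g n.+1; split.
  apply: leq_trans (size_polyD _ _) _; rewrite geq_max (leq_trans s1) //=.
  exact: leq_trans (size_scale_leq _ _) s2.
rewrite coefD coefZ c2 /= nth_default // add0r -mulrnAr //.
Qed.

Lemma coef_translate g n p : (size p <= n.+1)%N -> (translate g p)`_n = p`_n.
Proof.
move=> /(translate_diff g)[s _]; apply/eqP; rewrite eq_sym -subr_eq0 -coefB.
by rewrite nth_default.
Qed.

(** The backward difference operator is onto on polynomials, so that the main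
    terms of a recurrence f' x = f x + f' (x - g) can be solved exactly. *)
Lemma translate_diff_inv g n q : g != 0 -> (size q <= n)%N ->
  exists p, [/\ (size p <= n.+1)%N, p - translate g p = q & p`_n * g *+ n = q`_n.-1].
Proof.
move=> g0; elim: n q => [|n IH] q sq.
  exists 0; rewrite /translate comp_poly0 subrr size_poly0 coef0 mul0r mulr0n.
  by move: sq; rewrite leqn0 size_poly_eq0 => /eqP->; rewrite coef0.
pose c := q`_n / (g *+ n.+1).
have gn0 : g *+ n.+1 != 0 by rewrite mulrn_eq0 negb_or g0.
have [s1 c1] := translate_diffXn g n.+1.
pose q' := q - c *: ('X^(n.+1) - translate g 'X^(n.+1)).
have sq' : (size q' <= n)%N.
  apply/leq_sizeP => j; rewrite leq_eqVlt coefB coefZ.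
  case/orP => [/eqP<-|nj]; first by rewrite c1 /c divfK // subrr.
  by rewrite !nth_default ?mulr0 ?subrr // (leq_trans _ nj).
have [p [sp dp _]] := IH _ sq'; exists (p + c *: 'X^(n.+1)); split.
- apply: leq_trans (size_polyD _ _) _; rewrite geq_max (leq_trans sp) //=.
  by apply: leq_trans (size_scale_leq _ _) _; rewrite size_polyXn.
- move: dp; rewrite /q' /translate comp_polyD comp_polyZ scalerBr => dp.
  by rewrite opprD addrACA dp subrK.
- rewrite coefD coefZ coefXn eqxx mulr1 nth_default // add0r /c -mulrnAr.
  by rewrite divfK.
Qed.

(** * Functions with a two-term polynomial expansion on average *)

(** F is to be thought of as a primitive of f, whence the relation between the
    coefficients. Only the coefficient of degree n of p and those of degrees
    n + 1 and n of q are determined by f and F, but keeping whole polynomials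
    makes translations exact. *)
Definition expansion n f F p q : Prop :=
  [/\ (size p <= n.+1)%N, (size q <= n.+2)%N, q`_n.+1 *+ n.+1 = p`_n,
      below n (fun x => f x - p.[x]) & below n (fun x => F x - q.[x])].

(** The positivity of the leading coefficient makes the degree n exact and
    excludes cancellations in sums. *)
Definition polylike f F : Prop :=
  ((forall x, f x = 0) /\ (forall x, F x = 0)) \/
  exists n p q, expansion n f F p q /\ 0 < p`_n.

Lemma expansion0 n : expansion n (fun=> 0) (fun=> 0) 0 0.
Proof.
have b0 : below n (fun x => 0 - (0 : {poly R}).[x]).
  by exists 0, 0 => x _; rewrite horner0 subrr normr0 mul0r.
by split; rewrite ?size_poly0 // !coef0 mul0rn.
Qed.

Lemma expansion_add n f F p q f' F' p' q' :
  expansion n f F p q -> expansion n f' F' p' q' ->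
  expansion n (fun x => f x + f' x) (fun x => F x + F' x) (p + p') (q + q').
Proof.
move=> [sp sq pq bf bF] [sp' sq' pq' bf' bF']; split.
- by rewrite (leq_trans (size_polyD _ _)) // geq_max sp sp'.
- by rewrite (leq_trans (size_polyD _ _)) // geq_max sq sq'.
- by rewrite !coefD mulrnDl pq pq'.
- by have := below_add bf bf'; congr below; apply/funext => x; rewrite hornerD; ring.
- by have := below_add bF bF'; congr below; apply/funext => x; rewrite hornerD; ring.
Qed.

Lemma expansion_shift n f F p q g : expansion n f F p q ->
  expansion n (fun x => f (x - g)) (fun x => F (x - g)) (translate g p) (translate g q).
Proof.
move=> [sp sq pq bf bF]; split; rewrite ?size_translate ?coef_translate //.
- by have := below_shift g bf; congr below; apply/funext => x; rewrite horner_translate.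
- by have := below_shift g bF; congr below; apply/funext => x; rewrite horner_translate.
Qed.

Lemma expansion_mono n m f F p q : (n <= m)%N ->
  expansion n f F p q -> expansion m f F p q.
Proof.
rewrite leq_eqVlt => /orP[/eqP<-//|nm] [sp sq pq bf bF]; split.
- by apply: leq_trans sp _; lia.
- by apply: leq_trans sq _; lia.
- by rewrite !nth_default ?mul0rn // ?(leq_trans sp) ?(leq_trans sq) //; lia.
- by apply: below_mono bf; apply: ltnW.
- by apply: below_mono bF; apply: ltnW.
Qed.

(** The polynomials p' and q' solve the recurrences with right-hand sides p and q,
    and the remainders f' - p' and F' - q' have increments of order x ^ (n - 1).
    The leading coefficient p_n / (g (n + 1)) is that of a primitive of p / g. *)
Lemma expansion_step n f F p q f' F' g : 0 < g ->
  locally_bounded f' -> locally_bounded F' ->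
  (forall x, f' x = f x + f' (x - g)) -> (forall x, F' x = F x + F' (x - g)) ->
  expansion n f F p q ->
  exists p' q', expansion n.+1 f' F' p' q' /\ p'`_n.+1 * g *+ n.+1 = p`_n.
Proof.
move=> g0 bdf bdF ef eF [sp sq pq bf bF].
have [p' [sp' dp' cp']] := translate_diff_inv (lt0r_neq0 g0) sp.
have [q' [sq' dq' cq']] := translate_diff_inv (lt0r_neq0 g0) sq.
have incr (h h' : R -> R) (r r' : {poly R}) : locally_bounded h' ->
    (forall x, h' x = h x + h' (x - g)) -> r' - translate g r' = r ->
    below n (fun x => h x - r.[x]) -> below n.+1 (fun x => h' x - r'.[x]).
  move=> bdh eh dr bh; apply: (below_increment (x1 := 0) g0 _ bh) => [|x _].
    by apply: locally_bounded_sub => //; exact: locally_bounded_poly.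
  rewrite eh -dr !hornerE horner_translate; apply: le_trans (ler_normD _ _).
  by rewrite le_eqVlt; apply/orP; left; apply/eqP; congr `|_|; ring.
exists p', q'; split; last exact: cp'.
split=> //; [|exact: incr bdf ef dp' bf|exact: incr bdF eF dq' bF].
have g0' : g != 0 by rewrite gt_eqF.
rewrite /= in cp' cq'; apply: (mulIf g0'); apply: (@mulIf _ n.+1%:R).
  by rewrite pnatr_eq0.
by rewrite mulrnAl cq' !mulr_natr pq -cp'.
Qed.

Lemma polylike_add f F f' F' : polylike f F -> polylike f' F' ->
  polylike (fun x => f x + f' x) (fun x => F x + F' x).
Proof.
have ext (h h' : R -> R) : (forall x, h x = 0) -> (fun x => h x + h' x) = h'.
  by move=> h0; apply/funext => x; rewrite h0 add0r.
have ext' (h h' : R -> R) : (forall x, h' x = 0) -> (fun x => h x + h' x) = h.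
  by move=> h0; apply/funext => x; rewrite h0 addr0.
move=> [[f0 F0]|[n [p [q [e p0]]]]]; first by rewrite !ext.
move=> [[f0 F0]|[n' [p' [q' [e' p0']]]]].
  by rewrite !ext' //; right; exists n, p, q.
right; case: (ltngtP n n') => nn'.
- exists n', (p + p'), (q + q'); split.
    by apply: expansion_add => //; apply: expansion_mono e; exact: ltnW.
  by case: e => sp *; rewrite coefD nth_default ?add0r // (leq_trans sp).
- exists n, (p + p'), (q + q'); split.
    by apply: expansion_add => //; apply: expansion_mono e'; exact: ltnW.
  by case: e' => sp *; rewrite coefD [p'`_n]nth_default ?addr0 // (leq_trans sp).
- rewrite nn' in e p0; exists n', (p + p'), (q + q').
  by split; [exact: expansion_add | rewrite coefD addr_gt0].
Qed.

Lemma polylike_shift f F g : polylike f F ->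
  polylike (fun x => f (x - g)) (fun x => F (x - g)).
Proof.
move=> [[f0 F0]|[n [p [q [e p0]]]]]; first by left.
right; exists n, (translate g p), (translate g q); split; first exact: expansion_shift.
by case: e => sp *; rewrite coef_translate.
Qed.

Lemma periodic_eq0 h g : 0 < g -> (forall x, h x = h (x - g)) ->
  (forall x, x < 0 -> h x = 0) -> forall x, h x = 0.
Proof.
move=> g0 hg h0 x.
have step (m : nat) : h x = h (x - g * m%:R).
  by elim: m => [|m ->]; rewrite ?mulr0 ?subr0 // hg mulrSr; congr h; ring.
rewrite (step (Num.truncn (x / g)).+1) h0 //.
by have := truncnS_gt (x / g); rewrite ltr_pdivrMr // mulrC subr_lt0.
Qed.

Lemma polylike_step f F f' F' g : 0 < g ->
  locally_bounded f' -> locally_bounded F' ->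
  (forall x, x < 0 -> f' x = 0) -> (forall x, x < 0 -> F' x = 0) ->
  (forall x, f' x = f x + f' (x - g)) -> (forall x, F' x = F x + F' (x - g)) ->
  polylike f F -> polylike f' F'.
Proof.
move=> g0 bdf bdF f0' F0' ef eF [[f0 F0]|[n [p [q [e p0]]]]].
  left; split; apply: (periodic_eq0 g0) => // x.
    by rewrite ef f0 add0r.
  by rewrite eF F0 add0r.
have [p' [q' [e' cp']]] := expansion_step g0 bdf bdF ef eF e.
right; exists n.+1, p', q'; split=> //.
by move: p0; rewrite -cp' pmulrn_lgt0 // pmulr_lgt0.
Qed.

(** An upper bound on the growth bounds the exact degree, and an expansion may be
    read in any higher degree. *)
Lemma polylike_expansion n f F : polylike f F -> below n.+1 f ->
  exists p q, expansion n f F p q.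
Proof.
move=> [[f0 F0]|[m [p [q [e p0]]]]] bf.
  exists 0, 0; have -> : f = fun=> 0 by exact/funext.
  have -> : F = fun=> 0 by exact/funext.
  exact: expansion0.
exists p, q; have [mn|nm] := leqP m n; first exact: expansion_mono e.
case: e p0 => sp _ _ bfp _; rewrite below_coef0 ?ltxx // => {q}.
have := below_sub (below_mono nm bf) bfp; congr below.
by apply/funext => x; rewrite opprB addrCA subrr addr0.
Qed.

Lemma expansion_below n f F p q : expansion n f F p q -> below n f -> p`_n = 0.
Proof.
move=> [sp _ _ bfp _] bf; apply: below_coef0 => //.
have := below_sub bf bfp; congr below.
by apply/funext => x; rewrite opprB addrCA subrr addr0.
Qed.

End Asymptotics.

(** * Counting functions of down-sets *)

Section DownsetGrowth.
Variables (R : realType) (gam : nat -> R).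
Hypothesis gam_gt0 : forall i, 0 < gam i.

Definition cumul N (D : set (expo N)) := cumul_sum gam (fun=> 1) D.
Definition cumul_primitive N (D : set (expo N)) := cumul_sum gam id D.

Lemma cumul_locally_bounded N (D : set (expo N)) : locally_bounded (cumul D).
Proof.
apply: locally_bounded_homo => [x|]; first exact: cumul_sum_ge0.
exact: cumul_sum_homo.
Qed.

Lemma cumul_primitive_locally_bounded N (D : set (expo N)) :
  locally_bounded (cumul_primitive D).
Proof.
apply: locally_bounded_homo => [x|]; first exact: cumul_sum_ge0.
exact: cumul_sum_homo.
Qed.

(** By induction on the number of variables. The slices along the first entry
    decrease, so they stabilise from some J on; by induction on J one splits off
    the bottom slice until D is a cylinder over it, and then
    f_D x = f x + f_D (x - gam) with f the counting function of the slice. *)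
Lemma cumul_polylike N (D : set (expo N)) : downset D ->
  polylike (cumul D) (cumul_primitive D).
Proof.
elim: N D => [|N IH] D Ddown.
  case: (pselect (D tt)) => [Dt|Dt]; last first.
    left; split => x; rewrite /cumul /cumul_primitive /cumul_sum /=;
      case: ifP => _; by rewrite ?big_nil // big_cons big_nil asboolF.
  have cE u x : 0 <= x -> cumul_sum gam u (D : set (expo 0)) x = u x.
    by move=> x0; rewrite /cumul_sum /= x0 big_cons big_nil asboolT // addr0 subr0.
  right; exists 0%N, 1, 'X; split; last by rewrite coef1.
  split; rewrite ?size_poly1 ?size_polyX ?coefX ?coef1 ?mulr1n //.
    by exists 0, 0 => x x0; rewrite /cumul cE // hornerC subrr normr0 mul0r.
  by exists 0, 0 => x x0; rewrite /cumul_primitive cE // hornerX subrr normr0 mul0r.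
have slice_down j : downset [set t | D (expo_cons j t)].
  by move=> s t st; apply: Ddown; rewrite /= leqnn.
have [J stab] : exists J, forall i, (J <= i)%N ->
    [set t | D (expo_cons i t)] = [set t | D (expo_cons J t)].
  apply: (@downset_dcc _ (fun j => [set t | D (expo_cons j t)])) => // i j ij t.
  by apply: Ddown; rewrite /= ij expo_le_refl.
have splitc (E : set (expo N.+1)) x :
    cumul E x = cumul (bottom_slice E) x + cumul (lowered E) (x - gam N).
  exact: cumul_sum_split.
have splitp (E : set (expo N.+1)) x :
    cumul_primitive E x = cumul_primitive (bottom_slice E) x + cumul_primitive (lowered E) (x - gam N).
  exact: cumul_sum_split.
elim: J D Ddown slice_down stab => [|J IHJ] D Ddown slice_down stab.
  have lowE : lowered D = D.
    apply/seteqP; split=> -[j t] /=; rewrite /lowered /=;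
      have /seteqP[/(_ t) s1 /(_ t) s2] := stab j.+1 isT;
      have /seteqP[/(_ t) s3 /(_ t) s4] := stab j isT.
      by move=> /s1/s4.
    by move=> /s3/s2.
  apply: (@polylike_step _ (cumul (bottom_slice D)) (cumul_primitive (bottom_slice D)) _ _ (gam N)) => //.
  - exact: cumul_locally_bounded.
  - exact: cumul_primitive_locally_bounded.
  - by move=> x x0; exact: cumul_sum0.
  - by move=> x x0; exact: cumul_sum0.
  - by move=> x; rewrite {1}splitc lowE.
  - by move=> x; rewrite {1}splitp lowE.
  - exact/IH/slice_down.
have -> : cumul D = fun x => cumul (bottom_slice D) x + cumul (lowered D) (x - gam N).
  exact/funext.
have -> : cumul_primitive D =
    fun x => cumul_primitive (bottom_slice D) x + cumul_primitive (lowered D) (x - gam N).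
  exact/funext.
apply: polylike_add; first exact/IH/slice_down.
apply: polylike_shift; apply: IHJ.
- by move=> s t st; apply: Ddown; move: st => /=.
- by move=> j; exact: (slice_down j.+1).
- by move=> i Ji; exact: (stab i.+1).
Qed.

End DownsetGrowth.

(** * Averages of step functions *)

Section Averages.
Variable R : realType.
Implicit Types (f F : R -> R) (p q : {poly R}) (n : nat) (x T d : R).
Local Notation mu := (@lebesgue_measure R).

(** f counts the entries of ds that are at most x, and F is the primitive of f
    vanishing at - oo. The list depends on T since there may be infinitely many
    degrees in all. *)
Definition step_primitive f F : Prop := forall T, exists ds : seq R, forall x, x <= T ->
  f x = \sum_(d <- ds) (d <= x)%R%:R /\ F x = \sum_(d <- ds) Num.max (x - d) 0.

Lemma step_integral d T : 1 < T ->
  mu.-integrable `[1, T] (EFin \o (fun x => (d <= x)%R%:R)) /\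
  \int[mu]_(x in `[1, T]) (d <= x)%R%:R = Num.max (T - d) 0 - Num.max (1 - d) 0 :> R.
Proof.
move=> T1; pose c := Num.max 1 d.
have eqf x : x \in `[1, T]%classic -> (d <= x)%R%:R = \1_`[c, T]%classic x :> R.
  rewrite inE /= in_itv /= => /andP[x1 xT].
  by rewrite indicE; congr (_ : bool)%:R; apply/idP/idP; rewrite inE /= in_itv /= ge_max x1 xT andbT.
have mD : measurable (`[1, T]%classic : set R) by exact: measurable_itv.
split.
  apply: (@eq_integrable _ _ _ mu _ mD (EFin \o \1_`[c, T]%classic)).
    by move=> x xD /=; rewrite eqf.
  by apply: integrableS (integrable_indic_itv c T true false) => //; exact: measurableT.
rewrite (_ : \int[mu]_(x in `[1, T]) _ = \int[mu]_(x in `[1, T]) \1_`[c, T]%classic x); last first.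
  exact: eq_Rintegral.
rewrite /Rintegral integral_indic //.
have -> : (`[c, T] `&` `[1, T] = `[c, T] :> set R)%classic.
  apply/setIidPl => x /=; rewrite !in_itv /= ge_max => /andP[/andP[-> _] ->].
  by [].
have -> : fine (mu `[c, T]%classic) = fine (if (c < T)%R then T%:E - c%:E else 0)%E.
  by congr fine; rewrite [LHS]lebesgue_measure_itv /= lte_fin.
rewrite /c; case: ltP => cT /=; move: cT;
  case: (leP 1 d) => ?; case: (leP (T - d) 0) => ?; case: (leP (1 - d) 0) => ? cT; lra.
Qed.

Lemma step_primitive_integral f F T : step_primitive f F -> 1 < T ->
  mu.-integrable `[1, T] (EFin \o f) /\
  \int[mu]_(x in `[1, T]) f x = F T - F 1.
Proof.
move=> fF T1; have [ds dsP] := fF T.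
have mD : measurable (`[1, T]%classic : set R) by exact: measurable_itv.
have eqf x : x \in `[1, T]%classic -> f x = \sum_(d <- ds) (d <= x)%R%:R.
  by rewrite inE /= in_itv /= => /andP[_ /dsP[]].
have [int_sum sumE] : mu.-integrable `[1, T] (EFin \o (fun x => \sum_(d <- ds) (d <= x)%R%:R)) /\
    \int[mu]_(x in `[1, T]) (\sum_(d <- ds) (d <= x)%R%:R) =
    \sum_(d <- ds) (Num.max (T - d) 0 - Num.max (1 - d) 0) :> R.
  elim: (ds) => [|d ds' [IH1 IH2]].
    have -> : (fun x => \sum_(d <- [::]) (d <= x)%R%:R) = (fun=> 0 : R).
      by apply/funext => x; rewrite big_nil.
    by rewrite big_nil Rintegral_cst // mul0r; split=> //; exact: integrable0.
  have [i1 i2] := step_integral d T1.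
  have -> : (fun x => \sum_(e <- d :: ds') (e <= x)%R%:R) =
            (fun x => (d <= x)%R%:R + \sum_(e <- ds') (e <= x)%R%:R : R).
    by apply/funext => x; rewrite big_cons.
  rewrite RintegralD // i2 IH2 big_cons; split=> //.
  exact: (@integrableD _ _ _ mu _ mD (EFin \o _) (EFin \o _) i1 IH1).
split.
  apply: (@eq_integrable _ _ _ mu _ mD _ _ _ int_sum) => x xD /=.
  by rewrite eqf.
rewrite (_ : \int[mu]_(x in `[1, T]) _ = \int[mu]_(x in `[1, T]) (\sum_(d <- ds) (d <= x)%R%:R)); last first.
  exact: eq_Rintegral.
rewrite sumE sumrB.
by have [_ ->] := dsP T (lexx T); have [_ ->] := dsP 1 (ltW T1).
Qed.

Lemma poly_integral p T : 1 < T ->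
  mu.-integrable `[1, T] (EFin \o horner p^`()) /\
  \int[mu]_(x in `[1, T]) p^`().[x] = p.[T] - p.[1].
Proof.
move=> T1.
have cp (r : {poly R}) : {within `[1, T]%classic, continuous (horner r)}.
  by apply: continuous_subspaceT; exact: continuous_horner.
split.
  by apply: continuous_compact_integrable => //; exact: segment_compact.
rewrite /Rintegral (@continuous_FTC2 _ _ (horner p)) //=.
  split=> [x _||]; first exact: derivable_horner.
    by apply: cvg_at_right_filter; exact: continuous_horner.
  by apply: cvg_at_left_filter; exact: continuous_horner.
by move=> x _; rewrite derivE.
Qed.

Lemma below_average n (h : R -> R) : (0 < n)%N -> below n h ->
  (T ^- n * h T) @[T --> +oo] --> (0 : R).
Proof.
move=> n0 /belowP[C [x0 [C0 x01 hC]]].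
have inv0 : T^-1 @[T --> +oo] --> (0 : R).
  apply/(gtr0_cvgV0 (f := id)); last exact: cvg_id.
  by apply: nbhs_pinfty_gt; exact: num_real.
apply: (@squeeze_cvgr _ _ _ _ (fun T => - (C * n%:R * T^-1)) (fun T => C * n%:R * T^-1)).
- near=> T; rewrite -ler_norml.
  have T0 : x0 <= T by near: T; apply: nbhs_pinfty_ge; exact: num_real.
  have T1 : 0 < T by lra.
  have Tn : 0 < T ^+ n by exact: exprn_gt0.
  rewrite normrM ger0_norm ?invr_ge0 ?(ltW Tn) // ler_pdivrMl //; apply: le_trans (hC T T0) _.
  rewrite le_eqVlt; apply/orP; left; apply/eqP.
  case: n n0 {hC Tn} => [//|n] _ /=; rewrite exprS; field.
  by rewrite gt_eqF.
- rewrite -oppr0; apply: cvgN; rewrite -[X in _ --> X](mulr0 (C * n%:R)).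
  exact: cvgMr.
- rewrite -[X in _ --> X](mulr0 (C * n%:R)).
  exact: cvgMr.
Unshelve. all: by end_near.
Qed.

Lemma step_primitive0 : step_primitive (fun=> 0) (fun=> 0).
Proof. by move=> T; exists [::] => x _; rewrite !big_nil. Qed.

Lemma step_primitive_add f F f' F' : step_primitive f F -> step_primitive f' F' ->
  step_primitive (fun x => f x + f' x) (fun x => F x + F' x).
Proof.
move=> fF fF' T; have [ds dsP] := fF T; have [ds' dsP'] := fF' T.
exists (ds ++ ds') => x xT; rewrite !big_cat.
by have [-> ->] := dsP x xT; have [-> ->] := dsP' x xT.
Qed.

Lemma step_primitive_shift f F g : step_primitive f F ->
  step_primitive (fun x => f (x - g)) (fun x => F (x - g)).
Proof.
move=> fF T; have [ds dsP] := fF (T - g).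
exists [seq d + g | d <- ds] => x xT; rewrite !big_map.
have [|-> ->] := dsP (x - g); first by rewrite lerD2r.
split; apply: eq_bigr => d _; first by rewrite lerBrDr.
by congr Num.max; rewrite opprD addrCA addrC addrAC.
Qed.

Lemma step_primitive_cumul (gam : nat -> R) (gam_gt0 : forall i, 0 < gam i)
    N (D : set (expo N)) : step_primitive (cumul gam D) (cumul_primitive gam D).
Proof.
move=> T; exists [seq deg gam t | t <- expos gam N T & `[< D t >]] => x xT.
rewrite !big_map !big_filter /cumul /cumul_primitive !(cumul_sum_widen gam_gt0 _ _ xT).
rewrite !big_mkcondr; split; apply: eq_bigr => t _; first by case: ifP.
by case: leP => tx; rewrite maxEle; case: leP => //; lra.
Qed.

(** Differentiating the first two terms of q gives the first two terms of the
    expansion of f on average. *)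
Lemma expansion_constants n f F p q : (0 < n)%N -> expansion n f F p q ->
  step_primitive f F ->
  let a := n`!%:R * p`_n in let a' := n`!%:R * q`_n in
  (exists C : R, \forall x \near +oo,
     `|f x - a / n`!%:R * x ^+ n| <= C * `|x ^+ n.-1|) /\
  (T ^- n * \int[mu]_(x in `[1, T])
     (f x - a / n`!%:R * x ^+ n - a' / (n.-1)`!%:R * x ^+ n.-1))
     @[T --> +oo] --> (0 : R).
Proof.
move=> n0 [sp sq pq bf bF] fF a a'.
have fact0 m : m`!%:R != 0 :> R by rewrite pnatr_eq0 -lt0n fact_gt0.
have aE : a / n`!%:R = p`_n by rewrite /a mulrC mulKf.
have a'E : a' / (n.-1)`!%:R = n%:R * q`_n.
  rewrite /a'; case: n n0 {sp sq pq bf bF a a' aE} => [//|n] _ /=.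
  by rewrite factS natrM; field.
split.
  have [C [x0 [C0 x01 hC]]] := belowP (below_add bf (below_poly (size_sub_top sp))).
  exists (C * n%:R); near=> x.
  have xx0 : x0 <= x by near: x; apply: nbhs_pinfty_ge; exact: num_real.
  have := hC x xx0; rewrite hornerD hornerN hornerZ hornerXn aE addrA subrK.
  rewrite [`|x ^+ n.-1|]ger0_norm ?mulrA // exprn_ge0 //; lra.
(* By the relation between the top coefficients of p and q, the integrand is f - P'. *)
pose P := q`_n.+1 *: 'X^(n.+1) + q`_n *: 'X^n.
have sqP : (size (q - P)%R <= n)%N.
  have := size_sub_top (size_sub_top sq).
  by rewrite coefB coefZ coefXn ltn_eqF // mulr0 subr0 /P opprD addrA.
have PE x : P^`().[x] = p`_n * x ^+ n + n%:R * q`_n * x ^+ n.-1.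
  rewrite /P derivD !derivZ !derivXn !hornerE /= -pq.
  by rewrite !hornerMn !hornerXn !mulrnAr -mulrnAl -mulrA mulr_natl.
pose h T := F T - F 1 - (P.[T] - P.[1]).
have bh : below n h.
  have := below_add (below_add bF (below_poly sqP))
    (below_poly (leq_trans (size_polyC_leq1 (P.[1] - F 1)) n0)).
  congr below; apply/funext => x; rewrite /h hornerC hornerD hornerN; ring.
apply: cvg_trans (below_average n0 bh); apply: near_eq_cvg; near=> T.
have T1 : 1 < T by near: T; apply: nbhs_pinfty_gt; exact: num_real.
have [fint fE] := step_primitive_integral fF T1.
have [Pint PintE] := poly_integral P T1.
rewrite /h -fE -PintE -RintegralB //; congr (_ * _); apply: eq_Rintegral => x _.
by rewrite PE aE a'E opprD addrA.
Unshelve. all: by end_near.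
Qed.

End Averages.

(** * Linear algebra modulo a subspace *)

Section Span.
Variables (K A : pzRingType) (phi : {rmorphism K -> A}) (M : lmodType A).
Implicit Types (W U : set M) (s : seq M) (u v w : M).

Definition subspace W : Prop :=
  [/\ W 0, forall u v, W u -> W v -> W (u + v) & forall c u, W u -> W (phi c *: u)].

(** The span of s modulo W, by recursion on s so that the span of a concatenation
    is a span modulo a span. *)
Fixpoint span W s : set M :=
  if s is u :: s' then [set v | exists c, span W s' (v - phi c *: u)] else W.

Fixpoint indep W s : Prop :=
  if s is u :: s' then ~ span W s' u /\ indep W s' else True.

Lemma subspaceB W u v : subspace W -> W u -> W v -> W (u - v).
Proof.
move=> [_ WD WZ] Wu Wv; apply: WD => //.
by rewrite -scaleN1r -(rmorph1 phi) -rmorphN; apply: WZ.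
Qed.

Lemma subspace_sum W (I : Type) (r : seq I) (P : pred I) (F : I -> M) :
  subspace W -> (forall i, P i -> W (F i)) -> W (\sum_(i <- r | P i) F i).
Proof. by move=> [W0 WD _] WF; elim/big_ind: _. Qed.

Lemma span_subspace W s : subspace W -> subspace (span W s).
Proof.
elim: s => [|u s IH] //= /IH[S0 SD SZ]; split.
- by exists 0; rewrite rmorph0 scale0r subr0.
- move=> v v' [c Sv] [c' Sv']; exists (c + c').
  by rewrite rmorphD scalerDl opprD addrACA; apply: SD.
- move=> a v [c Sv]; exists (a * c).
  by rewrite rmorphM -scalerA -scalerBr; apply: SZ.
Qed.

Lemma span_base W s v : W v -> span W s v.
Proof.
elim: s v => [|u s IH] v //= /IH Wv.
by exists 0; rewrite rmorph0 scale0r subr0.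
Qed.

Lemma span_mem W s v : subspace W -> v \in s -> span W s v.
Proof.
move=> Wsub; elim: s => [|u s IH] //=; rewrite inE => /orP[/eqP->|/IH Wv].
  exists 1; rewrite rmorph1 scale1r subrr.
  by have [] := span_subspace s Wsub.
by exists 0; rewrite rmorph0 scale0r subr0.
Qed.

Lemma span_min W U s : subspace U -> W `<=` U -> (forall v, v \in s -> U v) ->
  span W s `<=` U.
Proof.
move=> Usub WU; elim: s => [|u s IH] //= sU v [c].
have [_ UD UZ] := Usub.
move=> /IH Uv; rewrite -(subrK (phi c *: u) v); apply: UD.
  by apply: Uv => w ws; apply: sU; rewrite inE ws orbT.
by apply: UZ; apply: sU; rewrite inE eqxx.
Qed.

Lemma span_mono W W' s s' : subspace W' -> W `<=` W' -> {subset s <= s'} ->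
  span W s `<=` span W' s'.
Proof.
move=> W'sub WW' ss'; apply: span_min.
- exact: span_subspace.
- by move=> v /WW'; exact: span_base.
- by move=> v /ss'; exact: span_mem.
Qed.

Lemma span_cat W s s' : span W (s ++ s') = span (span W s') s.
Proof. by elim: s => [|u s IH] //=; rewrite IH. Qed.

Lemma indep_cat W s s' : indep W (s ++ s') <-> indep (span W s') s /\ indep W s'.
Proof. by elim: s => [|u s IH] /=; rewrite ?span_cat; tauto. Qed.

Lemma indep_sub W W' s : subspace W' -> W `<=` W' -> indep W' s -> indep W s.
Proof.
move=> W'sub WW'; elim: s => [|u s IH] //= [nu /IH]; split=> //.
by move=> su; apply: nu; apply: span_mono su.
Qed.

Lemma subspace0 : subspace (set1 (0 : M)).
Proof. by split=> [//|u v -> ->|c u ->]; rewrite /= ?addr0 ?scaler0. Qed.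

Lemma span_map_sum (T : Type) (t0 : T) (f : T -> M) (s : seq T) v :
  span (set1 (0 : M)) (map f s) v ->
  exists c : {ffun 'I_(size s) -> K}, v = \sum_i phi (c i) *: f (nth t0 s i).
Proof.
elim: s v => [|u s IH] v /=.
  by move=> ->; exists [ffun=> 0]; rewrite big_ord0.
move=> [a /IH[c e]].
exists [ffun i => if unlift ord0 i is Some j then c j else a].
rewrite big_ord_recl ffunE unlift_none /= -[LHS](subrK (phi a *: f u)) e addrC.
by congr (_ + _); apply: eq_bigr => i _; rewrite ffunE fintype.liftK.
Qed.

Lemma span_sum s v : span (set1 (0 : M)) s v ->
  exists c : {ffun 'I_(size s) -> K}, v = \sum_i phi (c i) *: s`_i.
Proof. by rewrite -{1}[s]map_id; exact: span_map_sum. Qed.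

End Span.

(** A map that is linear over the scalars and reflects W' into W preserves
    independence. *)
Lemma span_map (K A A' : pzRingType) (phi : {rmorphism K -> A}) (phi' : {rmorphism K -> A'})
    (M : lmodType A) (M' : lmodType A') (f : M -> M') (W : set M) (W' : set M') s v :
  (forall c u w, f (u - phi c *: w) = f u - phi' c *: f w) ->
  (forall u, W' (f u) -> W u) -> span phi' W' (map f s) (f v) -> span phi W s v.
Proof.
move=> flin fW; elim: s v => [|u s IH] v /=; first exact: fW.
by move=> [c]; rewrite -flin => /IH; exists c.
Qed.

Lemma indep_map (K A A' : pzRingType) (phi : {rmorphism K -> A}) (phi' : {rmorphism K -> A'})
    (M : lmodType A) (M' : lmodType A') (f : M -> M') (W : set M) (W' : set M') s :
  (forall c u w, f (u - phi c *: w) = f u - phi' c *: f w) ->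
  (forall u, W' (f u) -> W u) -> indep phi W s -> indep phi' W' (map f s).
Proof.
move=> flin fW; elim: s => [|u s IH] //= [nu /IH]; split=> //.
by move=> /(span_map flin fW).
Qed.

Section Steinitz.
Variables (K : fieldType) (A : nzRingType) (phi : {rmorphism K -> A}) (M : lmodType A).
Implicit Types (W : set M) (s : seq M) (u v w : M).

(** The exchange property: u is a combination in which w has a nonzero
    coefficient. *)
Lemma span_exchange W s u w : subspace phi W ->
  span phi W (w :: s) u -> ~ span phi W s u -> span phi W (u :: s) w.
Proof.
move=> Wsub [c su] nu; have [_ SD SZ] := span_subspace s Wsub.
have c0 : c != 0.
  by apply: contra_notN nu => /eqP c0; move: su; rewrite c0 rmorph0 scale0r subr0.
exists c^-1; rewrite -[w]scale1r -(rmorph1 phi) -(mulVf c0) rmorphM -scalerA -scalerBr.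
rewrite -[_ - u]opprB -scaleN1r scalerA -(rmorph1 phi) -rmorphN -rmorphM.
exact: SZ.
Qed.

Lemma indep_extend W s w : subspace phi W ->
  ~ span phi W s w -> indep phi W s -> indep phi (span phi W [:: w]) s.
Proof.
move=> Wsub; elim: s => [//|u s IH] nw [nu ind]; split.
  move=> su; apply: nw; apply: span_exchange => //.
  move: su; rewrite -span_cat; apply: span_mono => // x.
  by rewrite mem_cat !inE orbC.
apply: IH => // sw; apply: nw; have := span_mono (s' := u :: s) Wsub _ _ sw.
by apply=> // x xs; rewrite inE xs orbT.
Qed.

(** Enlarging W by one vector costs an independent family at most one element,
    which is what an induction on the spanning family needs. *)
Lemma indep_drop W s w : subspace phi W -> indep phi W s ->
  exists s', [/\ {subset s' <= s}, (size s <= (size s').+1)%N &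
                 indep phi (span phi W [:: w]) s'].
Proof.
move=> Wsub; elim: s => [|u s IH]; first by exists [::].
move=> [nu ind]; have [sw|nsw] := pselect (span phi W s w); last first.
  exists s; split=> //; first by move=> x xs; rewrite inE xs orbT.
  exact: indep_extend.
have [s' [ss' szs' ind']] := IH ind; exists (u :: s'); split=> //.
  by move=> x; rewrite !inE => /orP[->//|/ss'->]; rewrite orbT.
split=> // su; apply: nu; apply: span_min su.
- exact: span_subspace.
- apply: span_min; first exact: span_subspace.
    by move=> v; exact: span_base.
  by move=> v; rewrite inE => /eqP->.
- by move=> v /ss'; exact: span_mem.
Qed.

Lemma steinitz W s s' : subspace phi W -> indep phi W s ->
  (forall v, v \in s -> span phi W s' v) -> (size s <= size s')%N.
Proof.
elim: s' W s => [|w s' IH] W s Wsub ind ss'.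
  case: s ind ss' => [|u s] //= [nu _] /(_ u); rewrite inE eqxx => /(_ isT) Wu.
  by case: nu; exact: span_base.
have [s1 [s1s szs ind1]] := indep_drop w Wsub ind.
apply: leq_trans szs _; rewrite ltnS; apply: (IH (span phi W [:: w])) => //.
  exact: span_subspace.
move=> v /s1s/ss'; rewrite -span_cat; apply: span_mono => // x.
by rewrite mem_cat !inE orbC.
Qed.

Lemma indep_span0 W s v : subspace phi W -> indep phi W s ->
  span phi (set1 0) s v -> W v -> v = 0.
Proof.
move=> Wsub; elim: s v => [|u s IH] v //= [nu ind] [c sv] Wv.
have [_ SD SZ] := span_subspace s Wsub.
have [c0|c0] := eqVneq c 0.
  by move: sv; rewrite c0 rmorph0 scale0r subr0 => /(IH _ ind); apply.
case: nu; rewrite -[u]scale1r -(rmorph1 phi) -(mulVf c0) rmorphM -scalerA; apply: SZ.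
have <- : v - (v - phi c *: u) = phi c *: u by rewrite opprB addrCA subrr addr0.
apply: subspaceB; [exact: span_subspace|exact: span_base|].
apply: span_mono sv => //; first by move=> _ ->; have [] := Wsub.
Qed.

Lemma indep_sum0 s (c : 'I_(size s) -> K) : indep phi (set1 (0 : M)) s ->
  \sum_i phi (c i) *: s`_i = 0 -> forall i, c i = 0.
Proof.
elim: s c => [|u s IH] c /=; first by move=> _ _ [].
move=> [nu ind]; rewrite big_ord_recl /= => e.
have sumS : span phi (set1 (0 : M)) s (\sum_(i < size s) phi (c (fintype.lift ord0 i)) *: s`_i).
  apply: (@subspace_sum _ _ phi) => [|i _]; first exact/span_subspace/subspace0.
  have [_ _ SZ] := span_subspace s (subspace0 phi M).
  by apply: SZ; apply: span_mem; [exact: subspace0 | exact: mem_nth].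
have c0 : c ord0 = 0.
  apply: contrapT => /eqP c0; apply: nu.
  have [_ SD SZ] := span_subspace s (subspace0 phi M).
  rewrite -[u]scale1r -(rmorph1 phi) -(mulVf c0) rmorphM -scalerA; apply: (SZ).
  move: e => /eqP; rewrite addr_eq0 => /eqP->.
  by rewrite -scaleN1r -(rmorph1 phi) -rmorphN; apply: SZ.
move: e; rewrite c0 rmorph0 scale0r add0r => /(IH (fun i => c (fintype.lift ord0 i)) ind) cl i.
by case: (unliftP ord0 i) => [j|] ->.
Qed.

End Steinitz.

(** * Dimension *)

Section Dimension.
Variables (K : fieldType) (V : lmodType K).

(** Each basis is expressed in the other one by a matrix; by uniqueness of
    coordinates the product of the two matrices is the identity, of rank d. *)
Lemma has_dim_leq (S : set V) d d' : has_dim S d -> has_dim S d' -> (d <= d')%N.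
Proof.
move=> [b [bS bP]] [b' [b'S b'P]].
have exP i : exists c : {ffun 'I_d' -> K}, b i = \sum_j c j *: b' j.
  by have [c [e _]] := b'P _ (bS i); exists c.
have exQ i : exists c : {ffun 'I_d -> K}, b' i = \sum_j c j *: b j.
  by have [c [e _]] := bP _ (b'S i); exists c.
have [P Pe] := choice exP; have [Q Qe] := choice exQ.
pose PM := \matrix_(i, j) P i j; pose QM := \matrix_(i, j) Q i j.
have PQ1 : PM *m QM = 1%:M.
  apply/matrixP => i l.
  have [c [_ cuniq]] := bP _ (bS i).
  have e1 : b i = \sum_j [ffun j => (PM *m QM) i j] j *: b j.
    rewrite {1}Pe; under eq_bigr do rewrite Qe scaler_sumr.
    rewrite exchange_big /=; apply: eq_bigr => j _; rewrite ffunE mxE scaler_suml.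
    by apply: eq_bigr => m _; rewrite !mxE scalerA.
  have e2 : b i = \sum_j [ffun j => (i == j)%:R] j *: b j.
    rewrite (bigD1 i) //= ffunE eqxx scale1r big1 ?addr0 // => j.
    by rewrite ffunE eq_sym => /negbTE->; rewrite scale0r.
  have /ffunP/(_ l) := etrans (esym (cuniq _ e1)) (cuniq _ e2).
  by rewrite !ffunE mxE => ->; rewrite mxE.
have <- : \rank (PM *m QM) = d by rewrite PQ1 mxrank1.
by apply: leq_trans (mxrankM_maxl _ _) _; exact: rank_leq_col.
Qed.

Lemma vdimE (S : set V) d : has_dim S d -> vdim S = d.
Proof.
move=> Sd; rewrite /vdim; case: xgetP => [e _ Se|/(_ d)//].
by apply/eqP; rewrite eqn_leq (has_dim_leq Se Sd) (has_dim_leq Sd Se).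
Qed.

End Dimension.

Section RestrictedDimension.
Variables (K : fieldType) (A : nzRingType) (phi : {rmorphism K -> A}) (M : lmodType A).

Lemma span_has_dim (S : set M) s : indep phi (set1 0) s ->
  (forall v, v \in s -> S v) -> S `<=` span phi (set1 0) s ->
  has_dim (S : set (restrict_scalars phi M)) (size s).
Proof.
move=> ind sS Ss; exists (fun i => s`_i : restrict_scalars phi M); split.
  by move=> i; apply: sS; exact: mem_nth.
move=> v /Ss/span_sum[c e]; exists c; split; first exact: e.
move=> c' e'; apply/ffunP => i; apply/eqP; rewrite -subr_eq0; apply/eqP.
have := @indep_sum0 _ _ phi M s (fun i => c i - c' i) ind; apply.
under eq_bigr do rewrite rmorphB scalerBl.
rewrite sumrB -e; apply/eqP; rewrite subr_eq0; apply/eqP; exact: e'.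
Qed.

End RestrictedDimension.

(** * Homogeneous components *)

Lemma fsum_seq (V : zmodType) (I : choiceType) (D : set I) (r : seq I) (f : I -> V) :
  uniq r -> (forall i, i \in r -> D i) -> (forall i, D i -> i \notin r -> f i = 0) ->
  \sum_(i \in D) f i = \sum_(i <- r) f i.
Proof.
move=> runiq rD f0; rewrite (fsbigE r) // [LHS]big_seq_cond [RHS]big_seq.
apply: eq_bigl => i; case: (boolP (i \in r)) => //= ir.
by apply/mem_set/rD.
Qed.

Lemma finite_support_seq (V : zmodType) (I : choiceType) (f : I -> V) :
  finite_set [set i | f i != 0] ->
  exists2 r : seq I, uniq r & forall i, i \notin r -> f i = 0.
Proof.
move=> /finite_seqP[s sE]; exists (undup s); first exact: undup_uniq.
move=> i; rewrite mem_undup => si; apply/eqP; apply: contraNT si => fi.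
by have : [set i | f i != 0] i by []; rewrite sE.
Qed.

Section Components.
Variables (R : realType) (V : zmodType) (G : R -> set V).
Hypothesis Gsum : direct_sum G.
Implicit Types (u v : V) (l x : R).

Let decomposition v :
  {f : R -> V | homogeneous_family G f /\ v = \sum_(l \in [set: R]) f l}.
Proof. by have [_ /(_ v) ex] := Gsum; apply: cid; case: ex => f []; exists f. Qed.

Definition hcomp v : R -> V := sval (decomposition v).

Lemma hcomp_in v l : G l (hcomp v l).
Proof. by have [[]] := svalP (decomposition v). Qed.

Lemma homogeneous0 l : G l 0.
Proof. by have [/(_ l)[]] := Gsum. Qed.

Lemma homogeneousB l u v : G l u -> G l v -> G l (u - v).
Proof. by have [/(_ l)[_ GB] _] := Gsum; exact: GB. Qed.

Lemma homogeneousD l u v : G l u -> G l v -> G l (u + v).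
Proof.
move=> Gu Gv; rewrite -[v]opprK; apply: homogeneousB => //.
by rewrite -sub0r; apply: homogeneousB => //; exact: homogeneous0.
Qed.

Lemma hcomp_uniq (r : seq R) (f : R -> V) : uniq r -> (forall l, G l (f l)) ->
  (forall l, l \notin r -> f l = 0) -> hcomp (\sum_(l <- r) f l) = f.
Proof.
move=> runiq Gf f0; set v := \sum_(l <- r) f l.
have [_ /(_ v)[g [_ guniq]]] := Gsum.
rewrite -(guniq f); first by apply/esym/guniq; exact: svalP (decomposition v).
split; last by rewrite (fsum_seq runiq) // => l _; exact: f0.
split=> //; apply: (@sub_finite_set _ _ [set` r]); last exact: finite_seq.
by move=> l /=; apply: contraR => /f0->; rewrite eqxx.
Qed.

Lemma hcomp_sum v : exists2 r : seq R, uniq r &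
  (forall l, l \notin r -> hcomp v l = 0) /\ v = \sum_(l <- r) hcomp v l.
Proof.
have [[_ fin] vE] := svalP (decomposition v); rewrite -/(hcomp v) in fin vE.
have [r runiq r0] := finite_support_seq fin.
exists r => //; split=> //.
by rewrite {1}vE (fsum_seq runiq) // => l _; exact: r0.
Qed.

Lemma hcomp_widen v (r : seq R) : uniq r -> (forall l, l \notin r -> hcomp v l = 0) ->
  v = \sum_(l <- r) hcomp v l.
Proof.
move=> runiq r0; have [_ vE] := svalP (decomposition v); rewrite -/(hcomp v) in vE.
by rewrite {1}vE (fsum_seq runiq) // => l _; exact: r0.
Qed.

Lemma hcompD u v l : hcomp (u + v) l = hcomp u l + hcomp v l.
Proof.
have [r _ [r0 _]] := hcomp_sum u; have [r' _ [r0' _]] := hcomp_sum v.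
pose s := undup (r ++ r').
have s0 l' : l' \notin s -> hcomp u l' = 0 /\ hcomp v l' = 0.
  by rewrite mem_undup mem_cat negb_or => /andP[/r0-> /r0'->].
rewrite [u in LHS](@hcomp_widen u s) ?undup_uniq //; last by move=> l' /s0[].
rewrite [v in LHS](@hcomp_widen v s) ?undup_uniq //; last by move=> l' /s0[].
rewrite -big_split (hcomp_uniq (f := fun l => hcomp u l + hcomp v l)) ?undup_uniq //.
  by move=> l'; apply: homogeneousD; exact: hcomp_in.
by move=> l' /s0[-> ->]; rewrite addr0.
Qed.

Lemma hcomp_homogeneous l v l' : G l v -> hcomp v l' = if l' == l then v else 0.
Proof.
move=> Gv; rewrite -[v in LHS](_ : \sum_(i <- [:: l]) (if i == l then v else 0) = v).
  rewrite (hcomp_uniq (f := fun i => if i == l then v else 0)) // => i.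
    by case: eqP => [->//|_]; exact: homogeneous0.
  by rewrite inE => /negbTE->.
by rewrite big_seq1 eqxx.
Qed.

Lemma hcomp0 l : hcomp 0 l = 0.
Proof. by rewrite (hcomp_homogeneous _ (homogeneous0 l)) eqxx. Qed.

Lemma hcompN v l : hcomp (- v) l = - hcomp v l.
Proof. by apply/eqP; rewrite -addr_eq0 -hcompD addNr hcomp0. Qed.

Lemma hcompB u v l : hcomp (u - v) l = hcomp u l - hcomp v l.
Proof. by rewrite hcompD hcompN. Qed.

Lemma hcomp_big (I : Type) (r : seq I) (P : pred I) (F : I -> V) l :
  hcomp (\sum_(i <- r | P i) F i) l = \sum_(i <- r | P i) hcomp (F i) l.
Proof.
by elim/big_rec2: _ => [|i u w _ <-]; rewrite ?hcomp0 // hcompD.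
Qed.

Lemma hcomp_inj u v : (forall l, hcomp u l = hcomp v l) -> u = v.
Proof.
move=> uv; have [r runiq [r0 ->]] := hcomp_sum u.
have [r0' ->] : (forall l, l \notin r -> hcomp v l = 0) /\ v = \sum_(l <- r) hcomp v l.
  have h l : l \notin r -> hcomp v l = 0 by rewrite -uv; exact: r0.
  by split=> //; exact: hcomp_widen.
exact: eq_bigr.
Qed.

Definition deg_le x : set V := [set v | forall l, x < l -> hcomp v l = 0].

Lemma deg_le_homogeneous l v x : G l v -> l <= x -> deg_le x v.
Proof.
move=> Gv lx l' xl'; rewrite (hcomp_homogeneous _ Gv) gt_eqF //.
exact: le_lt_trans xl'.
Qed.

Definition homogeneous (W : set V) : Prop := forall v l, W v -> W (hcomp v l).

Lemma truncateP x v : exists v', forall l, hcomp v' l = if l <= x then hcomp v l else 0.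
Proof.
have [r runiq [r0 _]] := hcomp_sum v.
exists (\sum_(l <- r) if l <= x then hcomp v l else 0) => l.
rewrite (hcomp_uniq (f := fun l => if l <= x then hcomp v l else 0)) // => l'.
  by case: ifP => _; [exact: hcomp_in | exact: homogeneous0].
by move=> /r0->; case: ifP.
Qed.

Definition truncate x v : V := sval (cid (truncateP x v)).

Lemma hcomp_truncate x v l : hcomp (truncate x v) l = if l <= x then hcomp v l else 0.
Proof. exact: svalP (cid (truncateP x v)) l. Qed.

Lemma deg_le_truncate x v : deg_le x (truncate x v).
Proof. by move=> l xl; rewrite hcomp_truncate leNgt xl. Qed.

Lemma truncate_id x v : deg_le x v -> truncate x v = v.
Proof.
move=> vx; apply: hcomp_inj => l; rewrite hcomp_truncate.
by case: leP => // /vx->.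
Qed.

Lemma truncateD x u v : truncate x (u + v) = truncate x u + truncate x v.
Proof.
apply: hcomp_inj => l; rewrite hcompD !hcomp_truncate hcompD.
by case: ifP; rewrite ?addr0.
Qed.

Lemma truncate_homogeneous x l v : G l v -> truncate x v = if l <= x then v else 0.
Proof.
move=> Gv; apply: hcomp_inj => l'; rewrite hcomp_truncate (hcomp_homogeneous _ Gv).
have -> : hcomp (if l <= x then v else 0) l' = if l <= x then if l' == l then v else 0 else 0.
  by case: ifP => _; rewrite ?hcomp0 // (hcomp_homogeneous _ Gv).
by case: eqP => [->//|_]; rewrite !if_same.
Qed.

Lemma truncation_deg_le x : truncation G x = deg_le x.
Proof.
apply/seteqP; split=> [_ [f [Gf fin] <-] l xl|v vx]; last first.
  exists (hcomp v); first exact: (svalP (decomposition v)).1.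
  have [r runiq [r0 vE]] := hcomp_sum v.
  have vE' : v = \sum_(l <- r | l <= x) hcomp v l.
    rewrite {1}vE (bigID (fun l => l <= x)) /= [X in _ + X]big1 ?addr0 // => l.
    by rewrite -ltNge => /vx.
  rewrite [RHS]vE' -[RHS]big_filter; apply: fsum_seq => [|l|l lx].
  - exact: filter_uniq.
  - by rewrite /= mem_filter => /andP[].
  - by rewrite mem_filter lx /=; exact: r0.
have [s suniq s0] := finite_support_seq fin; pose r := [seq l <- s | l <= x].
have runiq : uniq r by rewrite filter_uniq.
have r0 l' : l' <= x -> l' \notin r -> f l' = 0.
  by move=> lx; rewrite mem_filter lx /=; exact: s0.
rewrite (fsum_seq runiq) //; last by move=> l' /=; rewrite mem_filter => /andP[].
rewrite hcomp_big big_seq big1 // => l'; rewrite mem_filter => /andP[lx _].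
by rewrite (hcomp_homogeneous _ (Gf l')) gt_eqF // (le_lt_trans lx).
Qed.

End Components.

(** A truncation is a sum of homogeneous components. *)
Lemma subspace_homogeneous_truncate (R : realType) (K A : pzRingType)
    (phi : {rmorphism K -> A}) (M : lmodType A) (G : R -> set M) (Gsum : direct_sum G)
    (W : set M) x v :
  subspace phi W -> homogeneous Gsum W -> W v -> W (truncate Gsum x v).
Proof.
move=> Wsub Whom Wv; have [r runiq [r0 _]] := hcomp_sum Gsum (truncate Gsum x v).
rewrite (hcomp_widen runiq r0); apply: (@subspace_sum _ _ phi) => // l _.
rewrite hcomp_truncate; case: ifP => _; first exact: Whom.
by have [] := Wsub.
Qed.

Section GradedModule.
Variables (R : realType) (A : pzRingType) (GA : R -> set A) (M : lmodType A) (GM : R -> set M).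
Hypotheses (Asum : direct_sum (GA : R -> set A^o)) (Msum : direct_sum GM).
Hypothesis scaleG : forall g l a m, GA g a -> GM l m -> GM (g + l) (a *: m).

Lemma hcomp_scale g a m l : GA g a -> hcomp Msum (a *: m) l = a *: hcomp Msum m (l - g).
Proof.
move=> Ga; have [r runiq [r0 mE]] := hcomp_sum Msum m.
rewrite {1}mE scaler_sumr hcomp_big.
under eq_bigr do rewrite (hcomp_homogeneous Msum l (scaleG Ga (hcomp_in Msum m _))).
have [lr|lr] := boolP (l - g \in r); last first.
  rewrite r0 // scaler0 big_seq big1 // => i ir; case: eqP => // li.
  by move: lr; rewrite li addrC addKr ir.
rewrite (bigD1_seq (l - g)) //= subrKC eqxx big1 ?addr0 // => i ne.
by case: eqP => // le; move: ne; rewrite le addrC addKr eqxx.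
Qed.

Lemma hcomp_scale_homogeneous e (a : A) m l : GM e m ->
  hcomp Msum (a *: m) l = (hcomp Asum a (l - e) : A) *: m.
Proof.
move=> Gm; have [r runiq [r0 aE]] := hcomp_sum Asum a.
rewrite {1}aE scaler_suml hcomp_big.
under eq_bigr do rewrite (hcomp_homogeneous Msum l (scaleG (hcomp_in Asum a _) Gm)).
have [lr|lr] := boolP (l - e \in r); last first.
  rewrite r0 // scale0r big_seq big1 // => i ir; case: eqP => // li.
  by move: lr; rewrite li addrK ir.
rewrite (bigD1_seq (l - e)) //= subrK eqxx big1 ?addr0 // => i ne.
by case: eqP => // le; move: ne; rewrite le addrK eqxx.
Qed.

Lemma truncate_scale g a m x : GA g a ->
  truncate Msum x (a *: m) = a *: truncate Msum (x - g) m.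
Proof.
move=> Ga; apply: (@hcomp_inj _ _ _ Msum) => l.
rewrite (hcomp_scale _ _ Ga) !hcomp_truncate (hcomp_scale _ _ Ga) lerD2r.
by case: ifP; rewrite ?scaler0.
Qed.

Lemma truncate_scale_homogeneous e (a : A) m x : GM e m ->
  truncate Msum x (a *: m) = (truncate Asum (x - e) a : A) *: m.
Proof.
move=> Gm; apply: (@hcomp_inj _ _ _ Msum) => l.
rewrite (hcomp_scale_homogeneous _ _ Gm) !hcomp_truncate.
by rewrite (hcomp_scale_homogeneous _ _ Gm) lerD2r; case: ifP; rewrite ?scale0r.
Qed.

Lemma deg_le_scale g a m x : GA g a -> deg_le Msum x m -> deg_le Msum (x + g) (a *: m).
Proof.
by move=> Ga mx l xl; rewrite (hcomp_scale _ _ Ga) mx ?scaler0 // ltrBrDr.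
Qed.

Lemma deg_le_scale_homogeneous e (a : A) m x : GM e m ->
  deg_le Asum x a -> deg_le Msum (x + e) (a *: m).
Proof.
by move=> Gm ax l xl; rewrite (hcomp_scale_homogeneous _ _ Gm) ax ?scale0r // ltrBrDr.
Qed.

End GradedModule.

(** * Standard monomials *)

Section MonomialOrder.
Variables (R : realType) (gam : nat -> R).
Hypothesis gam_gt0 : forall i, 0 < gam i.

(** Comparing degrees first makes every initial segment finite, since the
    generators have positive degrees. *)
Definition mlt N (s t : expo N) : bool :=
  (deg gam s < deg gam t) || (deg gam s == deg gam t) && expo_lex s t.

Lemma mlt_irr N (s : expo N) : mlt s s = false.
Proof. by rewrite /mlt ltxx eqxx expo_lex_irr. Qed.

Lemma mlt_trans N : transitive (@mlt N).
Proof.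
move=> t s u; rewrite /mlt => /orP[st|/andP[/eqP-> st]] /orP[tu|/andP[/eqP<- tu]].
- by rewrite (lt_trans st tu).
- by rewrite st.
- by rewrite tu.
- by rewrite eqxx (expo_lex_trans st tu) orbT.
Qed.

Lemma mlt_total N (s t : expo N) : [|| s == t, mlt s t | mlt t s].
Proof. by rewrite /mlt; case: ltgtP; rewrite ?orbT //= => _; exact: expo_lex_total. Qed.

Lemma mlt_add N (u s t : expo N) : mlt (expo_add u s) (expo_add u t) = mlt s t.
Proof. by rewrite /mlt !deg_add ltrD2l expo_lex_add (inj_eq (addrI _)). Qed.

Lemma mlt_deg N (s t : expo N) : mlt s t -> deg gam s <= deg gam t.
Proof. by case/orP => [/ltW//|/andP[/eqP->]]. Qed.

Definition smaller N (t : expo N) : seq (expo N) :=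
  [seq s <- expos gam N (deg gam t) | mlt s t].

Lemma mem_smaller N (s t : expo N) : (s \in smaller t) = mlt s t.
Proof.
rewrite mem_filter mem_expos //; case: (boolP (mlt s t)) => //= st.
exact: mlt_deg.
Qed.

(** Well-founded induction, on the number of smaller monomials. *)
Lemma mlt_ind N (P : expo N -> Prop) :
  (forall t, (forall s, mlt s t -> P s) -> P t) -> forall t, P t.
Proof.
move=> Pstep t; move: {2}(size _) (leqnn (size (smaller t))) => m.
elim: m t => [|m IH] t tm; apply: Pstep => s st.
  have : s \in smaller t by rewrite mem_smaller.
  by move: tm; rewrite leqn0 size_eq0 => /eqP->.
apply: IH; rewrite -ltnS; apply: leq_trans tm.
have sub : {subset s :: smaller s <= smaller t}.
  move=> u; rewrite inE !mem_smaller => /orP[/eqP->//|us]; exact: mlt_trans st.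
have /uniq_leq_size/(_ sub) // : uniq (s :: smaller s).
by rewrite /= mem_smaller mlt_irr filter_uniq // expos_uniq.
Qed.

End MonomialOrder.

(** Linear independence over a domain, one element at a time. *)
Fixpoint lin_free (A : idomainType) (M : lmodType A) (s : seq M) : Prop :=
  if s is v :: s' then
    (forall a : A, span (@idfun A) (set1 0) s' (a *: v) -> a = 0) /\ lin_free s'
  else True.

Section StandardMonomials.
Variables (R : realType) (k : fieldType) (A : idomainType).
Variables (iota : {rmorphism k -> A}) (GA : R -> set A).
Hypothesis Asum : direct_sum (GA : R -> set A^o).
Hypothesis GA1 : GA 0 1.
Hypothesis GAM : forall g h a b, GA g a -> GA h b -> GA (g + h) (a * b).
Hypothesis GAiota : forall c, GA 0 (iota c).
Variables (N : nat) (y : nat -> A) (gam : nat -> R).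
Hypothesis gam_gt0 : forall i, 0 < gam i.
Hypothesis y_homogeneous : forall i, GA (gam i) (y i).

Fixpoint mon (m : nat) : expo m -> A :=
  if m is m'.+1 then fun t => y m' ^+ t.1 * mon t.2 else fun _ => 1.

(** This says that the monomials span A over k, in a form that allows proofs by
    linearity. *)
Hypothesis mon_gen : forall U : set A^o, subspace iota U ->
  (forall t : expo N, U (mon t)) -> forall a, U a.

Implicit Types (I J : set A^o) (s t u : expo N) (a b : A) (x d : R).

Let scaleA g l (a : A) (m : A^o) : GA g a -> GA l m -> GA (g + l) (a *: m).
Proof. exact: GAM. Qed.

Lemma homogeneousX g a m : GA g a -> GA (g *+ m) (a ^+ m).
Proof.
by move=> Ga; elim: m => [|m IH]; rewrite ?expr0 ?mulr0n // exprS mulrS; exact: GAM.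
Qed.

Lemma mon_homogeneous m (t : expo m) : GA (deg gam t) (mon t).
Proof.
elim: m t => [|m IH] /= t; first exact: GA1.
by apply: GAM; [exact: homogeneousX | exact: IH].
Qed.

Lemma mon_zero m : mon (expo_zero m) = 1.
Proof. by elim: m => //= m ->; rewrite expr0 mulr1. Qed.

Lemma mon_add m (s t : expo m) : mon (expo_add s t) = mon s * mon t.
Proof. by elim: m s t => [|m IH] /= s t; rewrite ?mulr1 // exprD IH mulrACA. Qed.

Definition ideal I : Prop := subspace (@idfun A : {rmorphism A -> A}) I.

Lemma ideal_subspace I : ideal I -> subspace iota I.
Proof. by move=> [I0 ID IZ]; split=> // c a; exact: IZ. Qed.

Local Notation mons := (map (fun t => mon t : A^o)).
Local Notation bd := (deg_le Asum).

(** The standard monomials of I; they form a basis of A/I. *)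
Definition standard I : set (expo N) :=
  [set t | ~ span iota I (mons (smaller gam t)) (mon t)].

(** In decreasing order, so that each entry is outside the span of the following
    ones by the definition of standard monomials. *)
Definition std_seq I x : seq (expo N) :=
  sort (fun s t => (s == t) || mlt gam t s) [seq t <- expos gam N x | `[< standard I t >]].

Definition std_mons I x : seq A^o := mons (std_seq I x).

Lemma mem_std_seq I x t : (t \in std_seq I x) = `[< standard I t >] && (deg gam t <= x).
Proof. by rewrite mem_sort mem_filter mem_expos. Qed.

Lemma size_std_mons I x : (size (std_mons I x))%:R = cumul gam (standard I) x.
Proof.
rewrite size_map size_sort size_filter /cumul /cumul_sum.
by rewrite -sum1_count natr_sum.
Qed.

(** A relation expressing a monomial by smaller ones can be multiplied by any
    monomial, because the order is compatible with products. *)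
Lemma std_down I : ideal I -> downset (standard I).
Proof.
move=> Iid s t /expo_leP[u ->] ut /= => nst; apply: ut.
pose U : set A^o := [set v | span iota I (mons (smaller gam (expo_add u s))) (mon u * v)].
have Usub : subspace iota U.
  have [S0 SD SZ] := span_subspace (mons (smaller gam (expo_add u s))) (ideal_subspace Iid).
  rewrite /U; split=> /=; first by rewrite mulr0.
    by move=> v w; rewrite mulrDr; exact: SD.
  by move=> c v Uv; rewrite -[_ *: v]/(iota c * v) mulrCA; exact: SZ.
rewrite mon_add; apply: (span_min Usub) nst => [v Iv|_ /mapP[v vs ->]].
  by apply: span_base; have [_ _ IZ] := Iid; exact: IZ.
rewrite /U /= -mon_add; apply: span_mem; first exact: ideal_subspace.
by apply: map_f; rewrite mem_smaller // mlt_add // -(mem_smaller gam_gt0).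
Qed.

Lemma std_anti I J : subspace iota J -> I `<=` J -> standard J `<=` standard I.
Proof. by move=> Jsub IJ t nt st; apply: nt; exact: span_mono st. Qed.

Lemma mon_deg_le x t : deg gam t <= x -> bd x (mon t).
Proof. by move=> tx; apply: deg_le_homogeneous tx; exact: mon_homogeneous. Qed.

Lemma std_mons_deg_le I x a : a \in std_mons I x -> bd x a.
Proof.
by move=> /mapP[t]; rewrite mem_std_seq => /andP[_ tx] ->; exact: mon_deg_le.
Qed.

Lemma deg_le_subspace x : subspace iota (bd x : set A^o).
Proof.
split=> [l xl|a b ax bx l xl|c a ax l xl]; first by rewrite hcomp0.
  by rewrite hcompD ax // bx // addr0.
by rewrite (hcomp_scale Asum scaleA _ _ (GAiota c)) subr0 ax ?scaler0.
Qed.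

(** A nonstandard monomial is rewritten in terms of smaller ones, whose degrees
    are not larger. *)
Lemma mon_std_span I x t : subspace iota I -> deg gam t <= x ->
  span iota I (std_mons I x) (mon t).
Proof.
move=> Isub; elim/(mlt_ind gam_gt0): t => t IH tx.
have [st|] := pselect (standard I t).
  apply: span_mem => //; apply: map_f; rewrite mem_std_seq tx andbT.
  exact/asboolP.
move=> /contrapT; apply: (span_min (U := span iota I (std_mons I x))).
- exact: span_subspace.
- by move=> v; exact: span_base.
- move=> v /mapP[s]; rewrite mem_smaller // => st ->; apply: IH => //.
  exact: le_trans (mlt_deg st) tx.
Qed.

(** Extended by linearity from monomials; truncation keeps the statement
    meaningful for elements of unbounded degree. *)
Lemma std_span I x a : subspace iota I -> bd x a -> span iota I (std_mons I x) a.
Proof.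
move=> Isub ax; rewrite -(truncate_id ax); move: a {ax}.
apply: (@mon_gen [set a | span iota I (std_mons I x) (truncate Asum x a)]).
  have [S0 SD SZ] := span_subspace (std_mons I x) Isub.
  split=> /=.
  - by rewrite truncate_id // => l _; rewrite hcomp0.
  - by move=> a b; rewrite truncateD; exact: SD.
  - move=> c a; rewrite (truncate_scale Asum scaleA _ _ (GAiota c)) subr0.
    exact: SZ.
move=> t /=; rewrite (truncate_homogeneous _ _ (mon_homogeneous t)).
case: ifP => [|_]; first exact: mon_std_span.
by have [] := span_subspace (std_mons I x) Isub.
Qed.

Lemma std_indep I x : subspace iota I -> indep iota I (std_mons I x).
Proof.
move=> Isub; rewrite /std_mons.
have std_all t : t \in std_seq I x -> standard I t.
  by rewrite mem_std_seq => /andP[/asboolP].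
have : pairwise (fun s t => mlt gam t s) (std_seq I x).
  have leT_tr : transitive (fun s t => (s == t) || mlt gam t s).
    move=> t s u /orP[/eqP->//|ts] /orP[/eqP<-|ut]; first by rewrite ts orbT.
    by rewrite (mlt_trans ut ts) orbT.
  have leT_tot : total (fun s t => (s == t) || mlt gam t s).
    by move=> s t; have := mlt_total gam s t; rewrite [t == s]eq_sym; case: eqP => //= _ /orP[]->; rewrite ?orbT.
  have := sort_sorted leT_tot [seq t <- expos gam N x | `[< standard I t >]].
  rewrite -/(std_seq I x) sorted_pairwise // => pw.
  have : uniq (std_seq I x) by rewrite sort_uniq filter_uniq // expos_uniq.
  rewrite uniq_pairwise => uq.
  have := pairwise_relI (fun s t => (s == t) || mlt gam t s) (fun s t => s != t) (std_seq I x).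
  rewrite pw uq /=; apply: sub_pairwise => s t /=.
  by case: eqP => //= _ /andP[].
elim: (std_seq I x) std_all => [//|t s IH] std_all /=; rewrite -/(map _ _).
move=> /andP[/allP ts pw]; split; last first.
  by apply: IH pw => t' t's; apply: std_all; rewrite inE t's orbT.
have := std_all t; rewrite inE eqxx => /(_ isT) nt st; apply: nt.
apply: span_mono st => // _ /mapP[t' t's ->]; apply: map_f.
by rewrite mem_smaller //; exact: ts.
Qed.

Lemma span_split (W : set A^o) (s : seq A^o) a : subspace iota W ->
  span iota W s a -> exists2 w, W w & span iota (set1 0) s (a - w).
Proof.
move=> Wsub; elim: s a => [|b s IH] a /=; first by exists a; rewrite ?subrr.
by move=> [c /IH[w Ww sw]]; exists w => //; exists c; rewrite addrAC.
Qed.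

Lemma std_mons_span_deg_le I x a : span iota (set1 0) (std_mons I x) a -> bd x a.
Proof.
apply: (span_min (U := bd x)); first exact: deg_le_subspace.
  by move=> _ -> l _; rewrite hcomp0.
exact: std_mons_deg_le.
Qed.



(** For I' = I + (a) this is the exactness in the middle of A/J -> A/I -> A/I',
    with multiplication by a on the left. Homogeneity of I and a keeps control of the degrees:
    an element of I' of degree at most x is i + a c with c of degree at most
    x - d after truncation. *)
Lemma cumul_std_le I I' J a d x : ideal I -> homogeneous Asum I -> ideal I' -> ideal J -> GA d a ->
  (forall b, J b -> I (a * b)) ->
  (forall b, I' b -> exists i c, I i /\ b = i + a * c) ->
  cumul gam (standard I) x <= cumul gam (standard I') x + cumul gam (standard J) (x - d).
Proof.
move=> Iid Ihom I'id Jid Ga aJ I'E.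
rewrite -!size_std_mons -natrD ler_nat.
have Isub := ideal_subspace Iid.
pose aJs := map (fun b : A^o => a *: b) (std_mons J (x - d)).
have -> : (size (std_mons I' x) + size (std_mons J (x - d)) = size (std_mons I' x ++ aJs))%N.
  by rewrite size_cat [size aJs]size_map.
apply: (steinitz Isub (std_indep x Isub)) => b /std_mons_deg_le bx.
have [b' I'b' sb'] := span_split (ideal_subspace I'id) (std_span (ideal_subspace I'id) bx).
have b'x : bd x b'.
  have -> : b' = b - (b - b') by rewrite opprB addrCA subrr addr0.
  apply: (subspaceB (deg_le_subspace x)) => //.
  exact: std_mons_span_deg_le sb'.
rewrite span_cat.
have [S0 SD SZ] := span_subspace (std_mons I' x) (span_subspace aJs Isub).
rewrite -(subrK b' b); apply: SD.
  by apply: span_mono sb' => //; [exact: span_subspace | move=> _ ->; have [] := span_subspace aJs Isub].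
apply: span_base; have [i [c [Ii b'E]]] := I'E _ I'b'.
have [_ aSD _] := span_subspace aJs Isub.
rewrite -(truncate_id b'x) b'E truncateD; apply: aSD.
  by apply: span_base; exact: (subspace_homogeneous_truncate x Isub Ihom Ii).
rewrite -[a * c]/(a *: (c : A^o)) (truncate_scale Asum scaleA _ _ Ga).
have := std_span (ideal_subspace Jid) (@deg_le_truncate _ _ _ Asum (x - d) c).
move: (truncate Asum (x - d) c) => e.
apply: (span_min (U := [set e | span iota I aJs (a *: e)])).
- have [T0 TD TZ] := span_subspace aJs Isub; split=> /=.
  + by rewrite scaler0.
  + by move=> u v; rewrite scalerDr; exact: TD.
  + by move=> z u; rewrite !scalerA mulrC -scalerA; exact: TZ.
- by move=> u Ju; apply: span_base; exact: aJ.
- by move=> u us; apply: span_mem => //; apply: map_f.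
Qed.

Definition zero_ideal : set A^o := [set 0].

Lemma zero_ideal_ideal : ideal zero_ideal.
Proof. exact: subspace0. Qed.

(** Multiplication by a is injective with image in I, so the multiples of the
    monomials by a are independent of the standard monomials of I. *)
Lemma cumul_std_ge I a d x : ideal I -> I a -> a != 0 -> GA d a ->
  cumul gam (standard I) x + cumul gam (standard zero_ideal) (x - d) <= cumul gam (standard zero_ideal) x.
Proof.
move=> Iid Ia a0 Ga; rewrite -!size_std_mons -natrD ler_nat.
pose as0 := map (fun b : A^o => a *: b) (std_mons zero_ideal (x - d)).
have -> : (size (std_mons I x) + size (std_mons zero_ideal (x - d)) = size (std_mons I x ++ as0))%N.
  by rewrite size_cat [size as0]size_map.
have Zsub := ideal_subspace zero_ideal_ideal.
have [I0 ID IZ] := Iid.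
apply: (steinitz Zsub).
  apply/indep_cat; split.
    apply: (indep_sub (W' := I)); [exact: ideal_subspace| |exact/std_indep/ideal_subspace].
    apply: (span_min (U := I)); [exact: ideal_subspace|by move=> _ ->|].
    by move=> _ /mapP[b _ ->]; rewrite /GRing.scale /= mulrC; exact: IZ.
  apply: indep_map (std_indep (x - d) Zsub) => [c u w|u]; last first.
    by move=> /eqP; rewrite mulf_eq0 (negbTE a0) => /eqP.
  by rewrite scalerBr; congr (_ - _); rewrite /GRing.scale /= mulrCA.
move=> b; rewrite mem_cat => /orP[/std_mons_deg_le bx|/mapP[c /std_mons_deg_le cx ->]].
  exact: std_span.
apply: std_span => //; rewrite -[x](subrK d).
exact: (@deg_le_scale _ _ _ _ _ Asum scaleA d a c (x - d) Ga cx).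
Qed.

(** If a is in J and is s + i with i in I and s a combination of standard
    monomials, then s is in J, and s = 0 since standard monomials are
    independent modulo J. *)
Lemma std_inj I J : ideal I -> ideal J -> I `<=` J -> standard I = standard J -> J `<=` I.
Proof.
move=> Iid Jid IJ IJstd a Ja.
have [x ax] : exists x, bd x a.
  have [r runiq [r0 _]] := hcomp_sum Asum a.
  have [x rx] : exists x, forall l, l \in r -> l <= x.
    elim: (r) => [|l r' [x rx]]; first by exists 0.
    exists (Num.max l x) => l'; rewrite inE le_max => /orP[/eqP->|/rx->].
      by rewrite lexx.
    by rewrite orbT.
  by exists x => l xl; apply: r0; apply: contraTN xl => /rx; rewrite -leNgt.
have Isub := ideal_subspace Iid; have Jsub := ideal_subspace Jid.
have [i Ii si] := span_split Isub (std_span Isub ax).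
have : a - i = 0.
  apply: (indep_span0 Jsub (std_indep x Jsub)).
    by rewrite /std_mons /std_seq -IJstd.
  by apply: (subspaceB Jsub) => //; exact: IJ.
by move=> /eqP; rewrite subr_eq0 => /eqP->.
Qed.

(** * Homogeneous ideals *)

Lemma seq_max_exists (r : seq R) (P : R -> Prop) : (exists2 l, l \in r & P l) ->
  exists l, P l /\ forall l', l' \in r -> P l' -> l' <= l.
Proof.
elim: r => [[]//|l r IH] [l0 l0r Pl0].
have [ex|nex] := pselect (exists2 l, l \in r & P l).
  have [m [Pm mmax]] := IH ex; have [Pl|nPl] := pselect (P l).
    have [lm|ml] := leP l m.
      by exists m; split=> // l'; rewrite inE => /orP[/eqP->//|]; exact: mmax.
    exists l; split=> // l'; rewrite inE => /orP[/eqP->//|l'r /(mmax _ l'r) l'm].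
    exact: le_trans (ltW ml).
  exists m; split=> // l'; rewrite inE => /orP[/eqP->//|]; exact: mmax.
move: l0r; rewrite inE => /orP[/eqP l0l|l0r]; last by case: nex; exists l0.
exists l0; split=> // l'; rewrite inE l0l => /orP[/eqP->//|l'r Pl'].
by case: nex; exists l'.
Qed.

Lemma ideal_components I a : ideal I -> (forall l, I (hcomp Asum a l)) -> I a.
Proof.
move=> Iid Ia; have [r _ [_ ->]] := hcomp_sum Asum a.
by apply: (subspace_sum _ Iid) => l _.
Qed.

(** The witness is the largest degree of a component of a outside I. *)
Lemma top_component I a : ideal I -> ~ I a ->
  exists l, ~ I (hcomp Asum a l) /\ I (a - truncate Asum l a).
Proof.
move=> Iid nIa; have [r runiq [r0 aE]] := hcomp_sum Asum a.
have I0 : I 0 by case: Iid.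
have [l [nIl lmax]] : exists l, ~ I (hcomp Asum a l) /\
    forall l', l' \in r -> ~ I (hcomp Asum a l') -> l' <= l.
  apply: (@seq_max_exists r (fun l => ~ I (hcomp Asum a l))).
  apply: contrapT => none; apply: nIa; rewrite aE big_seq.
  apply: (subspace_sum _ Iid) => l lr.
  by apply: contrapT => nIl; apply: none; exists l.
exists l; split=> //; apply: (ideal_components Iid) => l'.
rewrite hcompB hcomp_truncate; case: leP => [_|ll']; first by rewrite subrr.
rewrite subr0; apply: contrapT => nIl'.
have [/lmax/(_ nIl')|/r0 l'0] := boolP (l' \in r); first by rewrite leNgt ll'.
by apply: nIl'; rewrite l'0.
Qed.

Lemma hcomp_top a b l m : bd l a -> bd m b ->
  hcomp Asum (a * b) (l + m) = hcomp Asum a l * hcomp Asum b m.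
Proof.
move=> al bm; have [r runiq [r0 aE]] := hcomp_sum Asum a.
rewrite {1}aE mulr_suml hcomp_big.
have comp i : hcomp Asum (hcomp Asum a i * b) (l + m) =
    hcomp Asum a i * hcomp Asum b (l + m - i).
  exact: (hcomp_scale Asum scaleA _ _ (hcomp_in Asum a i)).
under eq_bigr do rewrite comp.
have other i : i != l -> hcomp Asum a i * hcomp Asum b (l + m - i) = 0.
  case: ltgtP => // [il|li] _; last by rewrite al // mul0r.
  by rewrite bm ?mulr0 //; lra.
have lE : hcomp Asum a l * hcomp Asum b m = hcomp Asum a l * hcomp Asum b (l + m - l).
  by rewrite addrC addKr.
rewrite lE; have [lr|lr] := boolP (l \in r).
  by rewrite (bigD1_seq l) //= big1 ?addr0.
rewrite r0 // mul0r big_seq big1 // => i ir; apply: other.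
by apply: contraNneq lr => <-.
Qed.

(** It is enough to test primality on homogeneous elements: the product of the
    top components of a and b outside I is the top component of ab modulo I. *)
Lemma homogeneous_prime I : ideal I -> homogeneous Asum I ->
  (forall d e a b, GA d a -> GA e b -> I (a * b) -> I a \/ I b) ->
  forall a b, I (a * b) -> I a \/ I b.
Proof.
move=> Iid Ihom Iprime a b Iab; apply: contrapT => /not_orP[nIa nIb].
have [l [nIal Ia]] := top_component Iid nIa.
have [m [nIbm Ib]] := top_component Iid nIb.
set a' := truncate Asum l a in Ia; set b' := truncate Asum m b in Ib.
have [_ ID IZ] := Iid.
have Ia'b' : I (a' * b').
  have -> : a' * b' = a * b - (b * (a - a') + a' * (b - b')).
    by rewrite -[a' * b']opprK; ring.
  apply: (subspaceB Iid) => //; apply: ID; exact: IZ.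
have := Ihom _ (l + m) Ia'b'.
rewrite hcomp_top; [|exact: deg_le_truncate..].
rewrite !hcomp_truncate !lexx.
by move=> /(Iprime _ _ _ _ (hcomp_in Asum a l) (hcomp_in Asum b m))[].
Qed.

Lemma zero_ideal_homogeneous : homogeneous Asum zero_ideal.
Proof. by move=> _ l ->; rewrite hcomp0. Qed.

Definition add_gen I a : set A^o := [set b | exists i c, I i /\ b = i + a * c].
Definition colon I a : set A^o := [set b | I (a * b)].

Lemma add_gen_ideal I a : ideal I -> ideal (add_gen I a).
Proof.
move=> [I0 ID IZ]; split.
- by exists 0, 0; rewrite mulr0 addr0.
- move=> _ _ [i [c [Ii ->]]] [i' [c' [Ii' ->]]]; exists (i + i'), (c + c').
  by split; [exact: ID | rewrite mulrDr addrACA].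
- move=> e _ [i [c [Ii ->]]]; exists (e *: i), (e * c); split; first exact: IZ.
  by rewrite /GRing.scale /= mulrDr mulrCA.
Qed.

Lemma add_gen_homogeneous I a d : GA d a -> homogeneous Asum I -> homogeneous Asum (add_gen I a).
Proof.
move=> Ga Ihom _ l [i [c [Ii ->]]]; exists (hcomp Asum i l), (hcomp Asum c (l - d)).
split; first exact: Ihom.
by rewrite hcompD; congr (_ + _); exact: (hcomp_scale Asum scaleA _ _ Ga).
Qed.

Lemma sub_add_gen I a : I `<=` add_gen I a.
Proof. by move=> i Ii; exists i, 0; rewrite mulr0 addr0. Qed.

Lemma add_gen_mem I a : ideal I -> add_gen I a a.
Proof. by move=> [I0 _ _]; exists 0, 1; rewrite mulr1 add0r. Qed.

Lemma colon_ideal I a : ideal I -> ideal (colon I a).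
Proof.
move=> [I0 ID IZ]; rewrite /colon; split=> /=.
- by rewrite mulr0.
- by move=> b c Ib Ic; rewrite mulrDr; exact: ID.
- by move=> e b Ib; rewrite -[_ *: b]/(e * b) mulrCA; exact: IZ.
Qed.

Lemma colon_homogeneous I a d : GA d a -> homogeneous Asum I -> homogeneous Asum (colon I a).
Proof.
move=> Ga Ihom b l Iab; rewrite /colon /=.
have := Ihom _ (l + d) Iab.
by rewrite [hcomp _ _ _](hcomp_scale Asum scaleA _ _ Ga) addrK.
Qed.

Lemma sub_colon I a : ideal I -> I `<=` colon I a.
Proof. by move=> [_ _ IZ] b Ib; exact: IZ. Qed.

(** Homogeneous ideals satisfy the ascending chain condition because down-sets
    of exponents satisfy the descending one. *)
Lemma maximal_homogeneous_ideal (P : set A^o -> Prop) I : ideal I -> homogeneous Asum I -> P I ->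
  exists J, [/\ ideal J, homogeneous Asum J, I `<=` J, P J &
    forall J', ideal J' -> homogeneous Asum J' -> J `<=` J' -> P J' -> J' `<=` J].
Proof.
move=> Iid Ihom PI; apply: contrapT => nomax.
pose T := {J : set A^o | [/\ ideal J, homogeneous Asum J, I `<=` J & P J]}.
have larger (J : T) : exists J' : T, sval J `<=` sval J' /\ ~ sval J' `<=` sval J.
  case: J => J [Jid Jhom IJ PJ] /=; apply: contrapT => none; apply: nomax.
  exists J; split=> // J' J'id J'hom JJ' PJ'; apply: contrapT => nJ'J; apply: none.
  have J'T : [/\ ideal J', homogeneous Asum J', I `<=` J' & P J'].
    by split=> //; exact: subset_trans JJ'.
  by exists (exist _ J' J'T).
have [f fP] := choice larger.
have IT : [/\ ideal I, homogeneous Asum I, I `<=` I & P I] by split.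
pose s i := sval (iter i f (exist _ I IT)).
have sid i : ideal (s i) by rewrite /s; case: (iter i f _) => ? [].
have sS i : s i `<=` s i.+1 by have [] := fP (iter i f (exist _ I IT)).
have s_incr i j : (i <= j)%N -> s i `<=` s j.
  elim: j => [|j IH]; first by rewrite leqn0 => /eqP->.
  by rewrite leq_eqVlt => /orP[/eqP->//|/IH/subset_trans]; apply.
have [K stab] : exists K, forall i, (K <= i)%N -> standard (s i) = standard (s K).
  apply: (@downset_dcc _ (fun i => standard (s i))) => [i|i j ij]; first exact/std_down.
  by apply: std_anti; [exact/ideal_subspace/sid | exact: s_incr].
have [_ ] := fP (iter K f (exist _ I IT)); apply.
by apply: (@std_inj (s K) (s K.+1)); rewrite ?stab.
Qed.

(** * Growth and chains of primes *)

(** The dimension of A/I in degrees at most x is not O(x ^ (e - 1)). By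
    cumul_polylike it then grows at least like x ^ e. *)
Definition growth_ge (e : nat) I : Prop := ~ below e (cumul gam (standard I)).

Lemma cumul_ge0 I x : 0 <= cumul gam (standard I) x.
Proof. by apply: cumul_sum_ge0. Qed.

Lemma cumul_below e I (h : R -> R) : (forall x, cumul gam (standard I) x <= h x) -> below e h ->
  below e (cumul gam (standard I)).
Proof.
move=> ch; apply: (below_le (x1 := 0)) => x _.
by rewrite ger0_norm ?cumul_ge0 // (le_trans (ch x)) // ler_norm.
Qed.

Lemma growth_ge_proper e I : ideal I -> growth_ge e I -> ~ I 1.
Proof.
move=> Iid grow I1; apply: grow; apply: (@cumul_below _ _ (fun=> 0)); last first.
  by exists 0, 0 => x _; rewrite normr0 mul0r.
move=> x; rewrite /cumul /cumul_sum big1 // => t /asboolP[].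
apply: span_base; have [_ _ IZ] := Iid.
by rewrite -[mon t]mulr1; exact: IZ.
Qed.

Lemma mon_in_ideal I m (t : expo m) : ideal I -> (forall i, I (y i)) ->
  mon t = 1 \/ I (mon t).
Proof.
move=> [I0 ID IZ] Iy; elim: m t => [|m IH]; first by left.
case=> -[|j] t /=; first by rewrite expr0 mul1r; exact: IH.
by right; rewrite exprS -mulrA mulrC; exact: IZ.
Qed.

(** If I contains all generators, A/I is spanned by 1 and does not grow. *)
Lemma growth_gen e I : ideal I -> growth_ge e.+1 I -> exists i, ~ I (y i).
Proof.
move=> Iid grow; apply: contrapT => /forallNP Iy; apply: grow.
apply: (@below_mono _ 1) => //; apply: (@cumul_below _ _ (fun=> 1)); last first.
  by exists 1, 0 => x _; rewrite expr0 normr1 !mulr1.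
move=> x; rewrite -size_std_mons -[1]/(1%:R) ler_nat.
have Isub := ideal_subspace Iid.
apply: (steinitz (s' := [:: (1 : A^o)]) Isub (std_indep x Isub)) => _ /mapP[t _ ->].
have Iy' i : I (y i) by apply: contrapT; exact: Iy.
case: (mon_in_ideal t Iid Iy') => [->|]; last exact: span_base.
by apply: span_mem => //; rewrite inE.
Qed.

Definition prime_ideal I : Prop :=
  [/\ ideal I, ~ I 1 & forall a b, I (a * b) -> I a \/ I b].

(** Killing a homogeneous element lowers the order of growth by at most one, and
    a maximal homogeneous ideal among those of at least a given growth is
    prime. *)
Lemma growth_step e I : ideal I -> homogeneous Asum I -> growth_ge e.+1 I ->
  exists J, [/\ prime_ideal J, homogeneous Asum J, growth_ge e J, I `<=` J & ~ J `<=` I].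
Proof.
move=> Iid Ihom grow; have [i nIy] := growth_gen Iid grow.
have sum_grow : growth_ge e (add_gen I (y i)).
  move=> bel; apply: grow.
  apply: (below_increment (x1 := 0) (gam_gt0 i) _ bel) => [|x _].
    exact: cumul_locally_bounded.
  rewrite !ger0_norm ?cumul_ge0 // addrC.
  apply: (@cumul_std_le _ _ _ (y i)) => //.
  - exact: add_gen_ideal.
  - by have [_ _ IZ] := Iid => b Ib; exact: IZ.
have [J [Jid Jhom IJ Jgrow Jmax]] := maximal_homogeneous_ideal
  (add_gen_ideal (y i) Iid) (add_gen_homogeneous (y_homogeneous i) Ihom) sum_grow.
exists J; split=> //; last first.
- by move=> JI; apply: nIy; apply/JI/IJ/add_gen_mem.
- by apply: subset_trans IJ; exact: sub_add_gen.
split=> //; first exact: growth_ge_proper Jgrow.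
apply: homogeneous_prime => // d d' a b Ga Gb Jab.
apply: contrapT => /not_orP[nJa nJb]; apply: Jgrow.
have small J' : ideal J' -> homogeneous Asum J' -> J `<=` J' -> ~ J' `<=` J ->
    below e (cumul gam (standard J')).
  by move=> J'id J'hom JJ' nJ'J; apply: contrapT => grow'; apply: nJ'J; exact: Jmax.
(* Both ideals are strictly larger than J, so their quotients grow more slowly. *)
have b1 : below e (cumul gam (standard (add_gen J a))).
  apply: small; [exact: add_gen_ideal|exact: add_gen_homogeneous Ga Jhom|exact: sub_add_gen|].
  by move=> /(_ a (add_gen_mem a Jid)).
have b2 : below e (cumul gam (standard (colon J a))).
  apply: small; [exact: colon_ideal|exact: colon_homogeneous Ga Jhom|exact: sub_colon|].
  by move=> /(_ b Jab).
apply: cumul_below (below_add b1 (below_shift d b2)) => x.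
apply: (@cumul_std_le _ _ _ a) => //; [exact: add_gen_ideal|exact: colon_ideal].
Qed.

Lemma growth_chain e I : prime_ideal I -> homogeneous Asum I -> growth_ge e I ->
  exists P : nat -> set A^o, [/\ P 0%N = I, forall i, (i <= e)%N -> prime_ideal (P i) &
    forall i j, (i < j <= e)%N -> P i `<=` P j /\ ~ P j `<=` P i].
Proof.
elim: e I => [|e IH] I Ipr Ihom grow.
  exists (fun=> I); split=> // i j /andP[ij]; rewrite leqn0 => /eqP j0.
  by move: ij; rewrite j0.
have [Iid _ _] := Ipr.
have [J [Jpr Jhom Jgrow IJ nJI]] := growth_step Iid Ihom grow.
have [P [P0 Ppr Pincr]] := IH J Jpr Jhom Jgrow.
exists (fun i => if i is i'.+1 then P i' else I); split=> // [[//|i] /Ppr//|].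
move=> [|i] [|j] //; last exact: Pincr.
move=> /andP[_ je]; have JP : J `<=` P j.
  rewrite -P0; case: j je => [_|j je]; first exact: subset_refl.
  by have [] := Pincr 0%N j.+1 je.
by split=> [|/(subset_trans JP)//]; exact: subset_trans JP.
Qed.

Lemma zero_ideal_prime : prime_ideal zero_ideal.
Proof.
split; first exact: zero_ideal_ideal.
  by move=> /eqP; rewrite oner_eq0.
by move=> a b /eqP; rewrite mulf_eq0 => /orP[]/eqP; [left|right].
Qed.

Lemma growth_prime_chain e : growth_ge e zero_ideal -> prime_chain A e.
Proof.
move=> grow; have [P [_ Ppr Pincr]] := growth_chain zero_ideal_prime zero_ideal_homogeneous grow.
exists (fun i a => `[< P i a >]); split=> [i|i j ij].
  have [[P0 PD PZ] P1 PM] := Ppr i (ltn_ord i); split.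
    split; first by apply/asboolP.
      by apply/asboolPn.
    move=> a u v /asboolP Pu /asboolP Pv; apply/asboolP; apply: PD => //.
    exact: PZ.
  by move=> u v /asboolP/PM[] h; apply/orP; [left|right]; apply/asboolP.
have ije : (i < j <= e)%N by rewrite ij -ltnS ltn_ord.
have [sub nsub] := Pincr i j ije; split.
- by move=> a /asboolP/sub h; apply/asboolP.
- by move=> h; apply: nsub => a /asboolP/h/asboolP.
Qed.

(** A faster growth would give a chain of primes of length n + 1. *)
Lemma below_krull_dim n : krull_dim A n -> below n.+1 (cumul gam (standard zero_ideal)).
Proof.
move=> [_ ub]; apply: contrapT => /growth_prime_chain/ub.
by rewrite ltnn.
Qed.

(** * Filtering a module by cyclic quotients *)

Section Filtration.
Variables (M : lmodType A) (GM : R -> set M).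
Hypothesis Msum : direct_sum GM.
Hypothesis scaleM : forall g l (a : A) m, GA g a -> GM l m -> GM (g + l) (a *: m).
Implicit Types (gs : seq (R * M)) (v w : M).

(** The entries of gs are paired with their degrees. *)
Definition gen_span gs : set M := span (@idfun A) (set1 0) (map snd gs).

Definition annih gs v : set A^o := [set a | gen_span gs ((a : A) *: v)].

Definition homogeneous_gens gs : Prop := forall p, p \in gs -> GM p.1 p.2.

(** The submodules generated by the tails of gs filter M, and the quotient of
    successive ones is A/I with I the annihilator of a generator modulo the
    later ones, shifted by the degree of the generator. *)
Fixpoint mod_basis gs x : seq M :=
  if gs is p :: gs' then
    map (fun a : A^o => (a : A) *: p.2) (std_mons (annih gs' p.2) (x - p.1)) ++ mod_basis gs' x
  else [::].

(** The Hilbert function for h = 1, and a primitive of it for h the identity. *)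
Fixpoint mod_sum (h : R -> R) gs x : R :=
  if gs is p :: gs' then
    cumul_sum gam h (standard (annih gs' p.2)) (x - p.1) + mod_sum h gs' x
  else 0.

Fixpoint free_rank gs : nat :=
  if gs is p :: gs' then (`[< annih gs' p.2 = zero_ideal >] + free_rank gs')%N else 0%N.

Lemma gen_span_submodule gs : subspace (@idfun A) (gen_span gs).
Proof. exact/span_subspace/subspace0. Qed.

Lemma gen_span_subspace gs : subspace iota (gen_span gs).
Proof. by have [S0 SD SZ] := gen_span_submodule gs; split=> // c v; exact: SZ. Qed.

Lemma annih_ideal gs v : ideal (annih gs v).
Proof.
have [S0 SD SZ] := gen_span_submodule gs; rewrite /annih; split=> /=.
- by rewrite scale0r.
- by move=> a b; rewrite scalerDl; exact: SD.
- by move=> c a; rewrite -[_ *: a]/(c * a) -scalerA; exact: SZ.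
Qed.

Lemma gen_span_homogeneous gs : homogeneous_gens gs -> homogeneous Msum (gen_span gs).
Proof.
elim: gs => [_ _ l ->|p gs IH] /=; first by rewrite hcomp0.
move=> Gp v l [c /= sv]; exists (hcomp Asum c (l - p.1)); rewrite /= in sv *.
have Gp0 : GM p.1 p.2 by apply: Gp; rewrite inE eqxx.
rewrite -(hcomp_scale_homogeneous Asum Msum scaleM c l Gp0).
by rewrite -hcompB; apply: IH => // q qs; apply: Gp; rewrite inE qs orbT.
Qed.

Lemma annih_homogeneous gs p : homogeneous_gens (p :: gs) -> homogeneous Asum (annih gs p.2).
Proof.
move=> Gp a l; rewrite /annih /= => sa.
have Ggs : homogeneous_gens gs by move=> q qs; apply: Gp; rewrite inE qs orbT.
have Gp0 : GM p.1 p.2 by apply: Gp; rewrite inE eqxx.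
have := gen_span_homogeneous Ggs (l + p.1) sa.
by rewrite (hcomp_scale_homogeneous Asum Msum scaleM a (l + p.1) Gp0) addrK.
Qed.

Lemma size_mod_basis gs x : (size (mod_basis gs x))%:R = mod_sum (fun=> 1) gs x.
Proof.
elim: gs => //= p gs IH.
by rewrite size_cat [size [seq _ | _ <- _]]size_map natrD size_std_mons IH.
Qed.

Lemma mod_basis_deg_le gs x v : homogeneous_gens gs -> v \in mod_basis gs x -> deg_le Msum x v.
Proof.
elim: gs => //= p gs IH Gp; rewrite mem_cat => /orP[/mapP[a /std_mons_deg_le ax ->]|].
  rewrite -[x](subrK p.1).
  have Gp0 : GM p.1 p.2 by apply: Gp; rewrite inE eqxx.
  exact: (@deg_le_scale_homogeneous _ _ _ _ _ Asum Msum scaleM _ a _ _ Gp0 ax).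
by apply: IH => q qs; apply: Gp; rewrite inE qs orbT.
Qed.

Lemma mod_basis_gen_span gs x v : v \in mod_basis gs x -> gen_span gs v.
Proof.
elim: gs v => //= p gs IH v; rewrite mem_cat => /orP[/mapP[a _ ->]|/IH sv].
  by exists a; rewrite subrr; have [] := gen_span_submodule gs.
by exists 0; rewrite /= scale0r subr0.
Qed.

Lemma mod_basis_indep gs x : homogeneous_gens gs -> indep iota (set1 0) (mod_basis gs x).
Proof.
elim: gs => //= p gs IH Gp; apply/indep_cat; split; last first.
  by apply: IH => q qs; apply: Gp; rewrite inE qs orbT.
apply: (indep_sub (gen_span_subspace gs)).
  apply: (span_min (gen_span_subspace gs)); last exact: mod_basis_gen_span.
  by move=> _ ->; have [] := gen_span_submodule gs.
have asub := ideal_subspace (annih_ideal gs p.2).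
apply: indep_map (std_indep (x - p.1) asub) => [c u w|//].
by rewrite scalerBl; congr (_ - _); rewrite scalerA.
Qed.

Lemma mod_basis_span gs x v : homogeneous_gens gs -> gen_span gs v -> deg_le Msum x v ->
  span iota (set1 0) (mod_basis gs x) v.
Proof.
elim: gs v => [_ _ -> //|p gs IH] v Gp [c sv] vx.
have Gp2 : GM p.1 p.2 by apply: Gp; rewrite inE eqxx.
have Ggs : homogeneous_gens gs by move=> q qs; apply: Gp; rewrite inE qs orbT.
rewrite /= span_cat.
set S := span iota _ (mod_basis gs x).
have Ssub : subspace iota S by apply: span_subspace; exact: subspace0.
pose ms := map (fun a : A^o => (a : A) *: p.2) (std_mons (annih gs p.2) (x - p.1)).
have [_ TD _] := span_subspace ms Ssub.
rewrite -(truncate_id vx) -(subrK (c *: p.2) v) truncateD; apply: (TD).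
  apply: span_base; apply: IH => //; last exact: deg_le_truncate.
  apply: (subspace_homogeneous_truncate x (gen_span_subspace gs) (gen_span_homogeneous Ggs)).
  exact: sv.
rewrite (truncate_scale_homogeneous Asum Msum scaleM _ _ Gp2).
have bc := @deg_le_truncate _ _ _ Asum (x - p.1) c.
have asub := ideal_subspace (annih_ideal gs p.2).
have [b Ib sb] := span_split asub (std_span asub bc).
move: sb bc Ib; move: (truncate Asum (x - p.1) c) => a sb ax Ib.
rewrite -(subrK b a) scalerDl; apply: TD; last first.
  apply: span_base; apply: IH => //.
  rewrite -[x](subrK p.1).
  apply: (@deg_le_scale_homogeneous _ _ _ _ _ Asum Msum scaleM _ b _ _ Gp2).
  have -> : b = a - (a - b) by rewrite opprB addrCA subrr addr0.
  apply: (subspaceB (deg_le_subspace (x - p.1))) => //.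
  exact: std_mons_span_deg_le sb.
move: (a - b) sb => e; apply: (span_min (U := [set e : A^o | span iota S ms ((e : A) *: p.2)])).
- have [T0 TD' TZ] := span_subspace ms Ssub; split=> /=.
  + by rewrite scale0r.
  + by move=> u w; rewrite scalerDl; exact: TD'.
  + by move=> z u; rewrite -[_ *: u]/(iota z * u) -scalerA; exact: TZ.
- by move=> _ -> /=; rewrite scale0r; have [] := span_subspace ms Ssub.
- by move=> u us; apply: span_mem => //; exact: map_f.
Qed.

Lemma truncation_has_dim gs x : homogeneous_gens gs -> (forall v, gen_span gs v) ->
  has_dim (truncation GM x : set (restrict_scalars iota M)) (size (mod_basis gs x)).
Proof.
move=> Ggs gen; rewrite (truncation_deg_le Msum).
apply: span_has_dim; first exact: mod_basis_indep.
  by move=> v; exact: mod_basis_deg_le.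
by move=> v vx; exact: mod_basis_span.
Qed.

Lemma hilbert_fun_mod_sum gs : homogeneous_gens gs -> (forall v, gen_span gs v) ->
  hilbert_fun iota GM = mod_sum (fun=> 1) gs.
Proof.
move=> Ggs gen; apply/funext => x; rewrite -size_mod_basis /hilbert_fun.
by rewrite (vdimE (truncation_has_dim x Ggs gen)).
Qed.

(** A nonzero homogeneous ideal I contains a nonzero homogeneous element, of
    degree d say, and then the count for I is at most f x - f (x - d) with f the
    count for 0, which is of lower order. *)
Lemma nonzero_ideal_below n I p q : ideal I -> homogeneous Asum I -> I <> zero_ideal ->
  expansion n (cumul gam (standard zero_ideal)) (cumul_primitive gam (standard zero_ideal)) p q ->
  below n (cumul gam (standard I)).
Proof.
move=> Iid Ihom I0 ex; have [a Ia a0] : exists2 a, I a & a != 0.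
  apply: contrapT => none; apply: I0; apply/seteqP; split=> [a Ia|_ ->]; last by case: Iid.
  by apply: contrapT => /eqP a0; apply: none; exists a.
have [l al0] : exists l, hcomp Asum a l != 0.
  apply: contrapT => none; move/eqP: a0; apply; apply: (@hcomp_inj _ _ _ Asum) => l.
  by rewrite hcomp0; apply: contrapT => /eqP al; apply: none; exists l.
have [sp _ _ bp _] := ex.
pose f := cumul gam (standard zero_ideal).
have fdiff : below n (fun x => f x - f (x - l)).
  have := below_add (below_sub bp (below_shift l bp)) (below_poly (translate_diff l sp).1).
  congr below; apply/funext => x; rewrite /f hornerD hornerN horner_translate.
  ring.
apply: cumul_below fdiff => x; rewrite lerBrDr.
exact: cumul_std_ge (Ihom _ _ Ia) al0 (hcomp_in Asum a l).
Qed.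

(** Only the quotients A/I with I = 0 contribute to the coefficient of degree
    n. *)
Lemma mod_sum_expansion n gs p q : homogeneous_gens gs -> below n.+1 (cumul gam (standard zero_ideal)) ->
  expansion n (cumul gam (standard zero_ideal)) (cumul_primitive gam (standard zero_ideal)) p q ->
  exists p' q', expansion n (mod_sum (fun=> 1) gs) (mod_sum id gs) p' q' /\
    p'`_n = p`_n *+ free_rank gs.
Proof.
move=> Ggs bel ex; elim: gs Ggs => [_|g gs IH Gp].
  exists 0, 0; split; last by rewrite coef0 mulr0n.
  exact: expansion0.
have Ggs : homogeneous_gens gs by move=> q' qs; apply: Gp; rewrite inE qs orbT.
have [p1 [q1 [ex1 lead1]]] := IH Ggs.
have Iid := annih_ideal gs g.2.
set I := annih gs g.2 in Iid *.
have [p2 [q2 [ex2 lead2]]] : exists p2 q2,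
    expansion n (cumul gam (standard I)) (cumul_primitive gam (standard I)) p2 q2 /\
    p2`_n = p`_n *+ `[< I = zero_ideal >].
  have [I0|I0] := pselect (I = zero_ideal).
    by exists p, q; rewrite I0 asboolT // mulr1n.
  have Ibel := nonzero_ideal_below Iid (annih_homogeneous Gp) I0 ex.
  have [p2 [q2 ex2]] := polylike_expansion (cumul_polylike gam_gt0 (std_down Iid))
    (below_mono (leqnSn n) Ibel).
  by exists p2, q2; rewrite asboolF // mulr0n; split=> //; exact: expansion_below ex2 Ibel.
exists (translate g.1 p2 + p1), (translate g.1 q2 + q1); split.
  exact: expansion_add (expansion_shift g.1 ex2) ex1.
rewrite coefD lead1 /= -/I mulrnDr -lead2; congr (_ + _).
by case: ex2 => sp2 *; rewrite coef_translate.
Qed.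

Lemma mod_sum_step_primitive gs : step_primitive (mod_sum (fun=> 1) gs) (mod_sum id gs).
Proof.
elim: gs => [|p gs IH]; first exact: step_primitive0.
exact: step_primitive_add (step_primitive_shift _ (step_primitive_cumul gam_gt0 _)) IH.
Qed.

Lemma hilbert_constants_mod_sum n gs p q : (0 < n)%N -> homogeneous_gens gs ->
  (forall v, gen_span gs v) -> below n.+1 (cumul gam (standard zero_ideal)) ->
  expansion n (cumul gam (standard zero_ideal)) (cumul_primitive gam (standard zero_ideal)) p q ->
  exists a' : R, hilbert_constants iota n GM (n`!%:R * (p`_n *+ free_rank gs)) a'.
Proof.
move=> n0 Ggs gen bel ex.
have [p' [q' [ex' lead]]] := mod_sum_expansion Ggs bel ex.
have := expansion_constants n0 ex' (mod_sum_step_primitive gs).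
rewrite lead -(hilbert_fun_mod_sum Ggs gen) => const.
by exists (n`!%:R * q'`_n).
Qed.

(** The generators whose annihilator modulo the later ones is zero: they are
    independent, and any other generator has a nonzero multiple in the span of
    the later ones, so it is torsion modulo the free ones. *)
Lemma free_generators gs : exists s : seq M, [/\ size s = free_rank gs, lin_free s,
  forall v, v \in s -> gen_span gs v &
  forall v, gen_span gs v -> exists2 a : A, a != 0 & span (@idfun A) (set1 0) s (a *: v)].
Proof.
have Zsub : subspace (@idfun A) (set1 (0 : M)).
  exact: subspace0.
elim: gs => [|p gs [s [szs sfree sgs tors]]].
  by exists [::]; split=> // v ->; exists 1; rewrite ?oner_eq0 // scaler0.
have sub_gs v : gen_span gs v -> gen_span (p :: gs) v.
  by move=> sv; exists 0; rewrite /= scale0r subr0.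
have span_gs v : span (@idfun A) (set1 0) s v -> gen_span gs v.
  apply: (span_min (gen_span_submodule gs)) => [_ ->|]; last exact: sgs.
  by have [] := gen_span_submodule gs.
have [Sz SD SZ] := span_subspace s Zsub.
have [I0|I0] := pselect (annih gs p.2 = zero_ideal).
  exists (p.2 :: s); split=> /=.
  - by rewrite asboolT // szs.
  - split=> // a /span_gs sa.
    by have : annih gs p.2 a by []; rewrite I0.
  - move=> v; rewrite inE => /orP[/eqP->|/sgs/sub_gs//].
    by apply: span_mem => //; rewrite inE eqxx.
  - move=> v [c /tors[a a0 sa]]; exists a => //; exists (a * c).
    by rewrite /= -scalerA -scalerBr.
have [b Ib b0] : exists2 b, annih gs p.2 b & b != 0.
  apply: contrapT => none; apply: I0; apply/seteqP; split=> [b Ib|_ ->].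
    by apply: contrapT => /eqP b0; apply: none; exists b.
  by have [] := annih_ideal gs p.2.
have [b' b'0 sb] := tors _ Ib.
exists s; split=> //=; first by rewrite asboolF.
  by move=> v /sgs/sub_gs.
move=> v [c /tors[a a0 sa]]; exists (a * (b' * b)); first by rewrite !mulf_neq0.
have -> : (a * (b' * b)) *: v = (b' * b) *: (a *: (v - c *: p.2)) + (a * c) *: (b' *: (b *: p.2)).
  rewrite !scalerBr !scalerA -addrA [X in _ + X](_ : _ = 0) ?addr0; first by congr (_ *: _); ring.
  by rewrite addrC; apply/eqP; rewrite subr_eq0; apply/eqP; congr (_ *: _); ring.
by apply: SD; exact: SZ.
Qed.

End Filtration.

End StandardMonomials.

(** * The rank of a module *)

Section BaseChange.
Variables (A B : comNzRingType) (phi : {rmorphism A -> B}) (M : lmodType A).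

Local Notation F := {freeg (M * B)%type / A}.
Local Notation gen m b := (<< ((m, b) : (M * B)%type) >> : F).
Local Notation proj := (\pi_(Quotient.quot (@tensor_null A B phi M))%qT : F -> base_change phi M).

Definition pure_tensor (m : M) (b : B) : base_change phi M := proj (gen m b).

Lemma pure_tensorDl m m' b : pure_tensor (m + m') b = pure_tensor m b + pure_tensor m' b.
Proof.
rewrite -projD; apply: proj_eq; apply: tensor_null_rel; left.
by exists m, m', b; rewrite opprD addrA.
Qed.

Lemma proj_scale_gen a m b : proj (a *: gen m b) = pure_tensor m (phi a * b).
Proof.
apply/esym/proj_eq; apply: tensor_null_rel; right; right; right.
by exists a, m, b.
Qed.

Lemma pure_tensorZ a m b : pure_tensor (a *: m) b = pure_tensor m (phi a * b).
Proof.
rewrite -proj_scale_gen; apply: proj_eq; apply: tensor_null_rel; right; right; left.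
by exists a, m, b.
Qed.

Lemma scale_pure_tensor c m b : c *: pure_tensor m b = pure_tensor m (c * b).
Proof. by rewrite /GRing.scale /= base_change_scaleE free_act_gen. Qed.

Lemma pure_tensor0 b : pure_tensor 0 b = 0.
Proof. by rewrite -{1}(scale0r (0 : M)) pure_tensorZ rmorph0 -scale_pure_tensor scale0r. Qed.

Lemma base_change_ind (P : base_change phi M -> Prop) :
  P 0 -> (forall x y, P x -> P y -> P (x + y)) -> (forall m b, P (pure_tensor m b)) ->
  forall x, P x.
Proof.
move=> P0 PD Pt x; have [y ->] := base_changeP x.
elim/free_ind: y => [|y z Py Pz|a m b].
- have -> : proj 0 = 0 by apply: (addIr (proj 0)); rewrite -projD !add0r.
  exact: P0.
- by rewrite projD; exact: PD.
- by rewrite proj_scale_gen; exact: Pt.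
Qed.

Lemma proj_eq0 (x : F) : proj x = 0 -> x \in @tensor_null A B phi M.
Proof.
have p0 : proj 0 = 0 by apply: (addIr (proj 0)); rewrite -projD !add0r.
by rewrite -p0 => /eqP; rewrite -Quotient.idealrBE subr0.
Qed.

(** The universal property of the tensor product, in the form needed to detect
    nonzero elements. *)
Lemma tensor_null_lift (V : lmodType B) (psi : M -> V) (x : F) :
  {morph psi : m m' / m + m'} -> (forall a m, psi (a *: m) = phi a *: psi m) ->
  x \in @tensor_null A B phi M ->
  fglift (fun p : (M * B)%type => p.2 *: psi p.1 : restrict_scalars phi V) x = 0.
Proof.
move=> psiD psiZ /tensor_nullP xN.
set L := fglift _; apply/eqP.
apply: (xN [pred x | L x == 0]) => [|y yrel]; rewrite ?inE.
  split; first by rewrite inE /L fglift0.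
  by move=> a u v; rewrite !inE /L fgliftD fgliftZ => /eqP-> /eqP->; rewrite scaler0 addr0.
have Lgen m b : L (gen m b) = b *: psi m by rewrite -[gen m b]scale1r /L fglift_gen scale1r.
have LB u v : L (u - v) = L u - L v by exact: fgliftB.
have LZ a u : L (a *: u) = phi a *: (L u : V) by exact: fgliftZ.
case: yrel => [[m [m' [b ->]]]|[[m [b [b' ->]]]|[[a [m [b ->]]]|[a [m [b ->]]]]]].
- by rewrite !LB !Lgen psiD scalerDr -addrA -opprD subrr.
- by rewrite !LB !Lgen scalerDl -addrA -opprD subrr.
- by rewrite LB LZ !Lgen psiZ !scalerA mulrC subrr.
- by rewrite LB LZ !Lgen scalerA subrr.
Qed.

End BaseChange.

Section Rank.
Variables (A : idomainType) (M : lmodType A) (s : seq M).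
Hypothesis sfree : lin_free s.
Hypothesis torsion : forall v, exists2 a : A, a != 0 & span (@idfun A) (set1 0) s (a *: v).

Lemma lin_free_sum0 (r : seq M) (c : 'I_(size r) -> A) : lin_free r ->
  \sum_i c i *: r`_i = 0 -> forall i, c i = 0.
Proof.
elim: r c => [|u r IH] c /=; first by move=> _ _ [].
move=> [nu ind]; rewrite big_ord_recl /= => e.
have [_ _ SZ] := span_subspace r (subspace0 (@idfun A) M).
have sumS : span (@idfun A) (set1 (0 : M)) r (\sum_(i < size r) c (fintype.lift ord0 i) *: r`_i).
  apply: (subspace_sum _ (span_subspace r (subspace0 (@idfun A) M))) => i _.
  by apply: SZ; apply: span_mem; [exact: subspace0 | exact: mem_nth].
have c0 : c ord0 = 0.
  apply: nu; move: e => /eqP; rewrite addr_eq0 => /eqP->.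
  by rewrite -scaleN1r; apply: SZ.
move: e; rewrite c0 scale0r add0r => /(IH (fun i => c (fintype.lift ord0 i)) ind) cl i.
by case: (unliftP ord0 i) => [j|] ->.
Qed.

Local Notation K := {fraction A}.
Local Notation frac := (@FracField.tofrac A : {rmorphism A -> K}).

Lemma frac_neq0 (a : A) : a != 0 -> frac a != 0.
Proof. by move=> a0; rewrite tofrac_eq0. Qed.

(** The coordinates of v in the family s, over the fraction field: v need not be
    in the span of s, but some nonzero multiple of it is. *)
Definition coordinates (v : M) (w : 'rV[K]_(size s)) : Prop :=
  exists a (c : 'I_(size s) -> A), [/\ a != 0, a *: v = \sum_i c i *: s`_i &
    w = \row_i (frac (c i) / frac a)].

Lemma coordinates_ex v : exists w, coordinates v w.
Proof.
have [a a0 /span_sum[c e]] := torsion v.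
by exists (\row_i (frac (c i) / frac a)), a, c.
Qed.

Lemma coordinates_uniq v w w' : coordinates v w -> coordinates v w' -> w = w'.
Proof.
move=> [a [c [a0 e ->]]] [a' [c' [a'0 e' ->]]].
have /lin_free_sum0 eq0 : \sum_i (a' * c i - a * c' i) *: s`_i = 0.
  under eq_bigr do rewrite scalerBl -!scalerA.
  by rewrite sumrB -!scaler_sumr -e -e' !scalerA mulrC subrr.
apply/rowP => i; rewrite !mxE; apply/eqP; rewrite eqr_div ?frac_neq0 //.
have /eqP := eq0 sfree i; rewrite subr_eq0 => /eqP h.
by rewrite -!rmorphM mulrC h mulrC.
Qed.

Lemma coordinatesD v v' w w' : coordinates v w -> coordinates v' w' ->
  coordinates (v + v') (w + w').
Proof.
move=> [a [c [a0 e ->]]] [a' [c' [a'0 e' ->]]].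
exists (a * a'), (fun i => a' * c i + a * c' i); split.
- by rewrite mulf_neq0.
- under eq_bigr do rewrite scalerDl -!scalerA.
  by rewrite big_split /= -!scaler_sumr -e -e' !scalerA [a' * a]mulrC scalerDr.
- apply/rowP => i; rewrite !mxE addf_div ?frac_neq0 //.
  by rewrite -!rmorphM -rmorphD; congr (frac _ / _); ring.
Qed.

Lemma coordinatesZ b v w : coordinates v w -> coordinates (b *: v) (frac b *: w).
Proof.
move=> [a [c [a0 e ->]]]; exists a, (fun i => b * c i); split=> //.
  by under eq_bigr do rewrite -scalerA; rewrite -scaler_sumr -e !scalerA mulrC.
by apply/rowP => i; rewrite !mxE rmorphM mulrA.
Qed.

Lemma coordinates_basis (i : 'I_(size s)) : coordinates s`_i (delta_mx 0 i).
Proof.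
exists 1, (fun j => (j == i)%:R); split; first exact: oner_neq0.
  rewrite scale1r (bigD1 i) //= eqxx scale1r big1 ?addr0 // => j /negbTE->.
  by rewrite scale0r.
by apply/rowP => j; rewrite !mxE rmorph1 divr1 rmorph_nat.
Qed.

(** The images of s form a basis of M tensored with the fraction field: they
    span it since M is torsion modulo s, and the coordinates of the elements of
    M extend to linear forms on the tensor product. *)
Lemma module_rank_free : module_rank M = size s.
Proof.
apply: vdimE; pose b i : base_change frac M := pure_tensor frac s`_i 1.
exists b; split=> // x _.
have Ssub := span_subspace [seq pure_tensor frac v 1 | v <- s] (subspace0 (@idfun K) (base_change frac M)).
have [S0 SD SZ] := Ssub.
have [c xE] : exists c : {ffun 'I_(size s) -> K}, x = \sum_i c i *: b i.
  apply: (@span_map_sum _ _ (@idfun K) _ _ 0 (fun v => pure_tensor frac v 1)).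
  elim/base_change_ind: x => [//|x y|v c]; first exact: SD.
  have [a a0 sa] := torsion v.
  have -> : pure_tensor frac v c = (c / frac a) *: pure_tensor frac (a *: v) 1.
    by rewrite pure_tensorZ scale_pure_tensor mulr1 divfK // frac_neq0.
  apply: (SZ); move: (a *: v) sa.
  apply: (span_min (U := [set u | span (@idfun K) (set1 0) [seq pure_tensor frac v 1 | v <- s] (pure_tensor frac u 1)])).
  - split=> /= [|u w|z u]; first by rewrite pure_tensor0.
      by rewrite pure_tensorDl; exact: SD.
    by rewrite pure_tensorZ -scale_pure_tensor; exact: SZ.
  - by move=> _ -> /=; rewrite pure_tensor0.
  - by move=> u us; apply: span_mem; [exact: subspace0 | exact: map_f].
exists c; split=> // c' xE'.
have [psi psiP] := choice coordinates_ex.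
have psiD : {morph psi : m m' / m + m'}.
  by move=> m m'; apply: coordinates_uniq (psiP _) _; exact: coordinatesD.
have psiZ a m : psi (a *: m) = frac a *: psi m.
  by apply: coordinates_uniq (psiP _) _; exact: coordinatesZ.
pose y : {freeg (M * K)%type / A} := \sum_(i < size s) << ((s`_i, c i - c' i) : (M * K)%type) >>.
have y0 : y \in @tensor_null A K frac M.
  apply: proj_eq0; have -> : (0 : base_change frac M) = \sum_(i < size s) (c i - c' i) *: b i.
    under eq_bigr do rewrite scalerBl.
    by rewrite sumrB -xE -xE' subrr.
  rewrite /y; elim/big_rec2: _ => [|i _ z _ <-].
    by apply: (addIr (pure_tensor frac 0 0)); rewrite -projD !add0r.
  by rewrite projD scale_pure_tensor mulr1.
have := tensor_null_lift psiD psiZ y0; set L := fglift _.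
have -> : L y = \sum_(i < size s) (c i - c' i) *: (psi s`_i : 'rV[K]_(size s)).
  rewrite /y /L; elim/big_rec2: _ => [|i _ z _ <-]; first exact: fglift0.
  rewrite fgliftD; congr (_ + _).
  by rewrite -[<< _ >>]scale1r fglift_gen scale1r.
move=> /rowP sum0; apply/ffunP => j; apply/eqP; rewrite -subr_eq0; apply/eqP.
have := sum0 j; rewrite summxE mxE (bigD1 j) //= big1 => [|i ij].
  by rewrite addr0 !mxE (coordinates_uniq (psiP _) (coordinates_basis j)) mxE !eqxx mulr1.
rewrite mxE (coordinates_uniq (psiP _) (coordinates_basis i)) mxE eqxx.
by rewrite eq_sym (negbTE ij) mulr0.
Qed.

End Rank.

(** * Homogeneous generators *)

Section Generators.
Variables (R : realType) (k : fieldType) (A : idomainType).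
Variables (iota : {rmorphism k -> A}) (GA : R -> set A) (Gamma : set R).
Hypothesis Asum : direct_sum (GA : R -> set A^o).
Hypothesis Gamma_ge0 : forall g, Gamma g -> 0 <= g.
Hypothesis GA_Gamma : forall g, ~ Gamma g -> GA g = [set 0].
Hypothesis GA0 : GA 0 = range iota.

(** The components lie in degrees of Gamma, hence of degree at least 0, and those
    of degree 0 are scalars. *)
Lemma positive_components (a : A) : exists (c : k) (hs : seq (R * A)),
  (forall p, p \in hs -> 0 < p.1 /\ GA p.1 p.2) /\ a = iota c + \sum_(p <- hs) p.2.
Proof.
have [r runiq [r0 aE]] := hcomp_sum Asum a.
have [c _ cE] : range iota (hcomp Asum a 0) by rewrite -GA0; exact: hcomp_in.
exists c, [seq (l, hcomp Asum a l : A) | l <- r & (l != 0) && (hcomp Asum a l != 0)].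
split=> [p /mapP[l]|].
  rewrite mem_filter => /andP[/andP[l0 al0] _] -> /=; split; last exact: hcomp_in.
  rewrite lt_neqAle eq_sym l0 /=; apply: Gamma_ge0; apply: contrapT => nl.
  have := hcomp_in Asum a l; rewrite GA_Gamma // => al.
  by move: al0; rewrite al eqxx.
rewrite big_map big_filter cE {1}aE.
rewrite [LHS](bigID (fun l => l == 0)) /=; congr (_ + _).
  have [r_0|r_0] := boolP (0 \in r); last first.
    rewrite r0 // big_seq_cond big1 // => l /andP[lr /eqP l0].
    by move: r_0; rewrite -l0 lr.
  rewrite -big_filter (_ : [seq l <- r | l == 0] = [:: 0]) ?big_seq1 //.
  by rewrite filter_pred1_uniq.
rewrite [LHS](bigID (fun l => hcomp Asum a l == 0)) /= big1 ?add0r //.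
by move=> l /andP[_ /eqP].
Qed.

Lemma positive_components_seq (s : seq A) : exists hs : seq (R * A),
  (forall p, p \in hs -> 0 < p.1 /\ GA p.1 p.2) /\
  forall a, a \in s -> exists c r, {subset r <= hs} /\ a = iota c + \sum_(p <- r) p.2.
Proof.
elim: s => [|a s [hs [hsP sP]]]; first by exists [::].
have [c [r [rP aE]]] := positive_components a.
exists (r ++ hs); split=> [p|b].
  by rewrite mem_cat => /orP[/rP|/hsP].
rewrite inE => /orP[/eqP->|/sP[d [r' [sub bE]]]].
  by exists c, r; split=> // p pr; rewrite mem_cat pr.
by exists d, r'; split=> // p /sub ph; rewrite mem_cat ph orbT.
Qed.

Lemma mon_var (y : nat -> A) m i : (i < m)%N -> exists t : expo m, mon y t = y i.
Proof.
elim: m => [//|m IH]; rewrite ltnS leq_eqVlt => /orP[/eqP->|/IH[t <-]].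
  by exists (expo_cons 1 (expo_zero m)); rewrite /= mon_zero expr1 mulr1.
by exists (expo_cons 0 t); rewrite /= expr0 mul1r.
Qed.

(** The components of positive degree of algebra generators generate as well.
    Beyond the list of generators, y is 0, given degree 1. *)
Lemma homogeneous_generators : fg_algebra iota ->
  exists (N : nat) (y : nat -> A) (gam : nat -> R),
    [/\ forall i, 0 < gam i, forall i, GA (gam i) (y i) &
      forall U : set A^o, subspace iota U -> (forall t : expo N, U (mon y t)) ->
      forall a, U a].
Proof.
move=> [s sgen]; have [hs [hsP sP]] := positive_components_seq s.
pose y i := (nth (1, 0) hs i).2; pose gam i := (nth (1, 0) hs i).1.
have homP i : 0 < gam i /\ GA (gam i) (y i).
  rewrite /y /gam; have [ihs|ihs] := ltnP i (size hs); first exact/hsP/mem_nth.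
  by rewrite nth_default //; split; [exact: ltr01 | exact: (homogeneous0 Asum)].
exists (size hs), y, gam; split=> [i|i|]; try by have [] := homP i.
pose S : {pred A} := fun a => `[< forall U : set A^o, subspace iota U ->
  (forall t : expo (size hs), U (mon y t)) -> U a >].
suff inS : forall a, a \in S by move=> U Usub Umon a; exact: (asboolP _ (inS a)).
have S1 : 1 \in S.
  by apply/asboolP => U _ /(_ (expo_zero _)); rewrite mon_zero.
have SB : {in S &, forall a b, a - b \in S}.
  move=> u v /asboolP Su /asboolP Sv; apply/asboolP => U Usub Umon.
  by apply: (subspaceB Usub); [exact: Su | exact: Sv].
have Siota c : iota c \in S.
  apply/asboolP => U Usub Umon; have [_ _ UZ] := Usub.
  have /asboolP/(_ U Usub Umon)/(UZ c) := S1.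
  by rewrite -[_ *: _]/(iota c * 1) mulr1.
have S0 : 0 \in S by rewrite -(subrr 1) SB.
have SD u v : u \in S -> v \in S -> u + v \in S.
  by move=> Su Sv; rewrite -[v]opprK SB // -sub0r SB.
apply: sgen => //; first split=> //.
  move=> u v /asboolP Su /asboolP Sv; apply/asboolP => U Usub Umon.
  have [U0 UD UZ] := Usub.
  apply: (Su [set a : A^o | U ((a : A) * v)]) => [|t].
    split=> /= [|a b|c a]; first by rewrite mul0r.
      by rewrite mulrDl; exact: UD.
    by rewrite -[_ *: a]/(iota c * a) -mulrA; exact: UZ.
  apply: (Sv [set a : A^o | U (mon y t * (a : A))]) => [|t'].
    split=> /= [|a b|c a]; first by rewrite mulr0.
      by rewrite mulrDr; exact: UD.
    by rewrite -[_ *: a]/(iota c * a) mulrCA; exact: UZ.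
  by rewrite /= -mon_add.
move=> a /sP[c [r [rhs ->]]]; apply: (SD) => //.
rewrite big_seq; elim/big_rec: _ => // p b pr Sb; apply: (SD) => //.
have ph : (index p hs < size hs)%N by rewrite index_mem rhs.
have [t tE] := mon_var y ph.
have -> : p.2 = mon y t by rewrite tE /y nth_index // rhs.
by apply/asboolP => U _ Umon.
Qed.

End Generators.

Lemma homogeneous_module_generators (R : realType) (A : idomainType) (M : lmodType A)
    (GM : R -> set M) (Msum : direct_sum GM) : fg_module M ->
  exists gs, homogeneous_gens GM gs /\ forall v, gen_span gs v.
Proof.
move=> [d [g gen]].
have [gs [Ggs gsP]] : exists gs, homogeneous_gens GM gs /\ forall v, v \in codom g -> gen_span gs v.
  elim: (codom g) => [|v vs [gs [Ggs gsP]]]; first by exists [::].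
  have [r runiq [_ vE]] := hcomp_sum Msum v.
  exists ([seq (l, hcomp Msum v l) | l <- r] ++ gs); split=> [p|w].
    by rewrite mem_cat => /orP[/mapP[l _ ->]|/Ggs//]; exact: hcomp_in.
  rewrite inE => /orP[/eqP->|/gsP].
    rewrite [v in gen_span _ v]vE big_seq.
    apply: (subspace_sum _ (gen_span_submodule _)) => l lr.
    apply: span_mem; first exact: subspace0.
    by rewrite map_cat mem_cat -map_comp (map_f (fun l => hcomp Msum v l)).
  apply: span_mono => //; first exact: subspace0.
  by move=> u us; rewrite map_cat mem_cat us orbT.
exists gs; split=> // v; have [c ->] := gen v.
have [_ _ SZ] := gen_span_submodule gs.
apply: (subspace_sum _ (gen_span_submodule gs)) => i _.
by apply: SZ; apply: gsP; exact: codom_f.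
Qed.

Unset Implicit Arguments.

Theorem theorem2p2 (R : realType) (k : closedFieldType) (n : nat)
    (Gamma : set R) (A : idomainType) (iota : {rmorphism k -> A})
    (GA : R -> set A) (M : lmodType A) (GM : R -> set M) :
  (0 < n)%N ->
  fg_submonoid Gamma -> (forall g, Gamma g -> 0 <= g) ->
  graded_ring GA -> (forall g, ~ Gamma g -> GA g = [set 0]) ->
  GA 0 = range iota -> fg_algebra iota -> krull_dim A n ->
  graded_module GA GM -> fg_module M ->
  (forall x, finite_dim (truncation GM x : set (restrict_scalars iota M))) /\
  exists a_n a_n1 : R,
    hilbert_constants iota n GM a_n a_n1 /\
    exists b_n b_n1 : R,
      hilbert_constants iota n (GA : R -> set A^o) b_n b_n1 /\
      a_n = (module_rank M)%:R * b_n.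
Proof.
move=> n0 _ Gamma_ge0 [Asum GA1 GAM] GA_Gamma GA0 fgA krull [Msum scaleM] fgM.
have GAiota c : GA 0 (iota c) by rewrite GA0; exists c.
have [N [y [gam [gam_gt0 y_homogeneous mon_gen]]]] :=
  @homogeneous_generators _ _ _ iota GA Gamma Asum Gamma_ge0 GA_Gamma GA0 fgA.
have [gs [Ggs gs_gen]] := homogeneous_module_generators Msum fgM.
pose f := cumul gam (standard iota y gam (N := N) (@zero_ideal A)).
have fbel : below n.+1 f.
  exact: (below_krull_dim Asum GA1 GAM GAiota gam_gt0 y_homogeneous mon_gen krull).
have [p [q ex]] := polylike_expansion
  (cumul_polylike gam_gt0 (std_down (iota := iota) (y := y) (gam := gam) gam_gt0 (@zero_ideal_ideal A))) fbel.
split=> [x|].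
  exists (size (mod_basis iota N y gam gs x)).
  exact: (truncation_has_dim Asum GA1 GAM GAiota gam_gt0 y_homogeneous mon_gen Msum scaleM).
have [a' Mconst] := hilbert_constants_mod_sum Asum GA1 GAM GAiota gam_gt0 y_homogeneous mon_gen
  Msum scaleM n0 Ggs gs_gen fbel ex.
(* A itself is generated by 1 in degree 0, with zero annihilator. *)
have A_homogeneous : homogeneous_gens (GA : R -> set A^o) [:: (0, 1 : A^o)].
  by move=> u; rewrite inE => /eqP->.
have A_gen (v : A^o) : gen_span [:: (0 : R, 1 : A^o)] v.
  by exists v; rewrite /= -[_ *: _]/(v * 1) mulr1 subrr.
have [b' Aconst] := hilbert_constants_mod_sum Asum GA1 GAM GAiota gam_gt0 y_homogeneous mon_gen
  (Asum : direct_sum (GA : R -> set A^o)) (fun g l a m => @GAM g l a m) n0 A_homogeneous A_gen fbel ex.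
exists (n`!%:R * (p`_n *+ free_rank gs)), a'; split=> //.
exists (n`!%:R * p`_n), b'; split.
  move: Aconst; rewrite /= asboolT ?addn0 ?mulr1n //.
  apply/seteqP; split=> v; rewrite /annih /gen_span /= -[_ *: _]/(v * 1) mulr1 //.
have [s [szs sfree _ tors]] := free_generators gs.
rewrite (module_rank_free sfree) => [|v]; last exact: tors.
by rewrite szs mulrnAr -mulr_natl.
Qed.
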